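(* Suppose that $\beta=0$. Let $\alpha=\alpha_0^{p^s}\in\mathcal{T}_2\setminus\{0\}$, where $\alpha_0\in\mathcal{T}_2$ is such that $x^n-\alpha_0$ is irreducible over $\mathcal{R}_2$. Then the following hold for $\alpha$-constacyclic codes of length $np^s$ over $\mathcal{R}_2$. (a) The code $\langle\gamma\rangle$ is the only isodual $\alpha$-constacyclic code of Type II over $\mathcal{R}_2$. (b) When $\operatorname{char}\mathcal{R}_2$ is an odd prime $p$, there does not exist any isodual $\alpha$-constacyclic code of Type III over $\mathcal{R}_2$ with either $G(x)=0$, or $G(x)\neq0$ and $p^s-2\omega+t\ge0$. When $\operatorname{char}\mathcal{R}_2=2$, the isodual $\alpha$-constacyclic codes of Type III over $\mathcal{R}_2$ are precisely the Type III codes of the form $\langle(x^n-\alpha_0)^{2^{s-1}}\rangle$, $\langle(x^n-\alpha_0)^{2^{s-1}}+\gamma(x^n-\alpha_0)^tG(x)\rangle$ and $\langle(x^n-\alpha_0)^\omega+\gamma G(x)\rangle$, where $\omega>2^{s-1}$ and $G(x)\neq0$. When $\operatorname{char}\mathcal{R}_2=4$, the codes $\langle(x^n-\alpha_0)^{2^{s-1}}\rangle$ and $\langle(x^n-\alpha_0)^{2^{s-1}}+\gamma(x^n-\alpha_0)^tG(x)\rangle$ are isodual $\alpha$-constacyclic codes of Type III over $\mathcal{R}_2$ for each $G(x)\neq0$ and for each integer $t\ge1$ (with $G,t$ as in the description of Type III codes). (c) When $\operatorname{char}\mathcal{R}_2=2$, the isodual $\alpha$-constacyclic codes of Type IV over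 $\mathcal{R}_2$ are precisely the Type IV codes of the form $\langle(x^n-\alpha_0)^\omega+\gamma(x^n-\alpha_0)^tG(x),\gamma(x^n-\alpha_0)^{2^s-\omega}\rangle$, where $2^{s-1}<\omega<2^s$ and $0\le t<2^s-\omega$ if $G(x)\neq0$. When $\operatorname{char}\mathcal{R}_2$ is an odd prime $p$, the $\alpha$-constacyclic codes $\langle(x^n-\alpha_0)^\omega,\gamma(x^n-\alpha_0)^{p^s-\omega}\rangle$, $\frac{p^s}{2}<\omega<p^s$, are isodual codes of Type IV over $\mathcal{R}_2$. When $\operatorname{char}\mathcal{R}_2=p^2$, the $\alpha$-constacyclic codes $\langle(x^n-\alpha_0)^\omega,\gamma(x^n-\alpha_0)^{p^s-\omega}\rangle$, $\frac{2p^s-p^{s-1}}{2}\le\omega<p^s$, are isodual codes of Type IV over $\mathcal{R}_2$.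
   Context: $\mathcal{R}_2$ is a finite commutative chain ring with unity, with maximal ideal $\langle\gamma\rangle$, where $\gamma\neq0$ and $\gamma^2=0$; its residue field has order $p^m$, $p$ prime; $\operatorname{char}\mathcal{R}_2\in\{p,p^2\}$. $\zeta\in\mathcal{R}_2$ has multiplicative order $p^m-1$ and $\mathcal{T}_2=\{0,1,\zeta,\dots,\zeta^{p^m-2}\}$. $n,s$ are positive integers with $\gcd(n,p)=1$. For a unit $\lambda$, a $\lambda$-constacyclic code of length $N$ over $\mathcal{R}_2$ is a submodule of $\mathcal{R}_2^N$ closed under $(a_0,\dots,a_{N-1})\mapsto(\lambda a_{N-1},a_0,\dots,a_{N-2})$, identified via $(a_i)\mapsto\sum a_ix^i$ with an ideal of $\mathcal{R}_2[x]/\langle x^N-\lambda\rangle$. Here $\lambda=\alpha$ (i.e. $\beta=0$ in $\lambda=\alpha+\gamma\beta$). The dual code is $\mathcal{C}^\perp=\{u\in\mathcal{R}_2^N:\sum u_ic_i=0\ \forall c\in\mathcal{C}\}$. $\mathcal{C}$ is isodual if it is $\mathcal{R}_2$-linearly equivalent to $\mathcal{C}^\perp$, i.e. $\mathcal{C}^\perp$ is the image of $\mathcal{C}$ under a monomial transformation of $\mathcal{R}_2^N$ (a permutation of coordinates combined with multiplication of each coordinate by a unit). Put $\mathcal{R}_{\alpha,0}=\mathcal{R}_2[x]/\langle x^{np^s}-\alpha\rangle$ and $f(x)=x^n-\alpha_0$. $\mathcal{P}_n(\mathcal{T}_2)$ is the set of polynomials with coefficients in $\mathcal{T}_2$ that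 are $0$ or of degree less than $n$. The ideals of $\mathcal{R}_{\alpha,0}$ are: Type I: $\{0\}$, $\mathcal{R}_{\alpha,0}$. Type II: $\langle\gamma f^\tau\rangle$, $0\le\tau<p^s$. Type III: $\langle f^\omega+\gamma f^tG\rangle$, where $0<\omega<p^s$, $0\le t<\kappa$ if $G\neq0$, and $G$ is $0$ or a unit of $\mathcal{R}_{\alpha,0}$ of the form $\sum_{i=0}^{\kappa-t-1}a_i(x)f(x)^i$ with $a_i\in\mathcal{P}_n(\mathcal{T}_2)$. Type IV: $\langle f^\omega+\gamma f^tG,\gamma f^\mu\rangle$, where $0\le\mu<\kappa\le\omega<p^s$, $0\le t<\mu$ if $G\neq0$, and $G$ is $0$ or a unit of $\mathcal{R}_{\alpha,0}$ of the form $\sum_{i=0}^{\mu-t-1}a_i(x)f(x)^i$ with $a_i\in\mathcal{P}_n(\mathcal{T}_2)$. In both types $\kappa$ is the smallest non-negative integer with $\gamma f^\kappa\in\langle f^\omega+\gamma f^tG\rangle$. *)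

(* Defs.v *)
From HB Require Import structures.
From mathcomp Require Import all_boot all_algebra all_fingroup.

Set Implicit Arguments.
Unset Strict Implicit.
Unset Printing Implicit Defensive.

Import GRing.Theory.

Local Open Scope ring_scope.

(* [GRing.unit] needs a [unitRingType], which neither {poly R} nor a quotient
   of it is when R has zero divisors. *)
Definition invertible (S : comNzRingType) (a : S) : Prop :=
  exists b : S, a * b = 1.

(* [irreducible_poly] is only available over an integral domain. *)
Definition irreducible_elt (S : comNzRingType) (a : S) : Prop :=
  [/\ a != 0, ~ invertible a
    & forall b c : S, a = b * c -> invertible b \/ invertible c].

HB.instance Definition _ (R : finComNzRingType) (h : {poly R}) :=
  Finite.on {poly %/ h}.

Section Ideals.

Variable S : finComNzRingType.

Definition is_ideal (I : {set S}) : Prop :=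
  [/\ 0 \in I, {in I &, forall x y, x + y \in I}
    & forall a, {in I, forall x, a * x \in I}].

Definition ideal_gen (gs : seq S) : {set S} :=
  [set x | [exists c : {ffun 'I_(size gs) -> S},
              x == \sum_(i < size gs) c i * gs`_i]].

Definition maximal_ideal (M : {set S}) : Prop :=
  [/\ is_ideal M, M != [set: S]
    & forall I, is_ideal I -> M \subset I -> I = M \/ I = [set: S]].

Definition chain_ring : Prop :=
  forall I J, is_ideal I -> is_ideal J -> I \subset J \/ J \subset I.

(* Order of the quotient ring S / I: the index of the additive subgroup I. *)
Definition quotient_order (I : {set S}) : nat := #|[set: S] : I|%g.

(* The kernel of the canonical map from the integers to S is generated by c. *)
Definition has_char (c : nat) : Prop :=
  forall k : nat, (k%:R == 0 :> S) = (c %| k)%N.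

Definition teichmuller_set (z : S) (d : nat) : {set S} :=
  0 |: [set z ^+ i | i : 'I_d].

End Ideals.

Section Codes.

Variables (R : finComUnitRingType) (N : nat).
Implicit Types (c u : 'rV[R]_N) (C : {set 'rV[R]_N}).

Definition linear_code C : Prop :=
  [/\ 0 \in C, {in C &, forall c u, c + u \in C}
    & forall a : R, {in C, forall c, a *: c \in C}].

(* [ord_pred] is cyclic: the entry of index 0 is lambda * c_(N-1). *)
Definition constacyclic_shift (lambda : R) c : 'rV[R]_N :=
  \row_i ((if i == 0 :> nat then lambda else 1) * c 0 (ord_pred i)).

Definition constacyclic (lambda : R) C : Prop :=
  linear_code C /\ {in C, forall c, constacyclic_shift lambda c \in C}.

Definition dual_code C : {set 'rV[R]_N} :=
  [set u : 'rV[R]_N | [forall c in C, \sum_i u 0 i * c 0 i == 0]].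

Definition monomial_map (sigma : 'S_N) (d : 'I_N -> R) c : 'rV[R]_N :=
  \row_i (d i * c 0 (sigma i)).

Definition isodual C : Prop :=
  exists (sigma : 'S_N) (d : 'I_N -> R),
    (forall i, d i \is a GRing.unit) /\
    dual_code C = monomial_map sigma d @: C.

Definition isodual_constacyclic (lambda : R) C : Prop :=
  constacyclic lambda C /\ isodual C.

End Codes.

Section Types.

(* e stands for p ^ s, and T for the Teichmuller set. *)
Variables (R : finComUnitRingType) (gamma : R) (T : {set R}) (n e : nat).
Variables (alpha0 alpha : R).

Definition Ralpha : finComNzRingType :=
  {poly %/ ('X^(n * e) - alpha%:P : {poly R})}.

Definition to_Ralpha (a : {poly R}) : Ralpha :=
  in_qpoly ('X^(n * e) - alpha%:P) a.

Definition fR : Ralpha := to_Ralpha ('X^n - alpha0%:P).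

Definition gammaR : Ralpha := to_Ralpha gamma%:P.

Definition code_of (I : {set Ralpha}) : {set 'rV[R]_(n * e)} :=
  [set c | to_Ralpha (rVpoly c) \in I].

Definition genG (omega t : nat) (G : Ralpha) : Ralpha :=
  fR ^+ omega + gammaR * fR ^+ t * G.

Definition is_kappa (g : Ralpha) (kappa : nat) : Prop :=
  gammaR * fR ^+ kappa \in ideal_gen [:: g] /\
  forall k, gammaR * fR ^+ k \in ideal_gen [:: g] -> (kappa <= k)%N.

Definition in_Pn (a : {poly R}) : Prop :=
  (size a <= n)%N /\ a \is a polyOver T.

Definition admissible (bound t : nat) (G : Ralpha) : Prop :=
  (G != 0 -> (t < bound)%N) /\
  (G = 0 \/
   invertible G /\
   exists a : nat -> {poly R}, (forall i, in_Pn (a i)) /\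
     G = \sum_(0 <= i < bound - t) to_Ralpha (a i) * fR ^+ i).

Definition typeII (C : {set 'rV[R]_(n * e)}) : Prop :=
  exists tau : nat,
    (tau < e)%N /\ C = code_of (ideal_gen [:: gammaR * fR ^+ tau]).

Definition typeIII (omega t : nat) (G : Ralpha)
    (C : {set 'rV[R]_(n * e)}) : Prop :=
  exists kappa : nat,
    [/\ (0 < omega < e)%N, is_kappa (genG omega t G) kappa,
        admissible kappa t G & C = code_of (ideal_gen [:: genG omega t G])].

Definition typeIV (omega t : nat) (G : Ralpha) (mu : nat)
    (C : {set 'rV[R]_(n * e)}) : Prop :=
  exists kappa : nat,
    [/\ is_kappa (genG omega t G) kappa, (mu < kappa <= omega)%N,
        (omega < e)%N, admissible mu t G
      & C = code_of (ideal_gen [:: genG omega t G; gammaR * fR ^+ mu])].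

End Types.

(* Main.v *)
Require Import Defs.
From mathcomp Require Import all_boot all_algebra all_fingroup.
From mathcomp Require Import ring zify.

(** Write A for R[x]/(x^N - alpha), N = n e, e = p^s, and put f = x^n - alpha0.

    Duality is annihilation.  Identify words of length N with elements of A.
    The inner product of u and c is the coefficient of x^(N-1) in the product
    of c and of u read backwards.  An ideal is stable under multiplication by
    x, so the dual of the code of an ideal I is the reversed code of the
    annihilator of I ([dual_code_of]).  Reversal is a permutation of the
    coordinates: the code of I is isodual if and only if I and Ann(I) are
    monomially equivalent.

    Counting.  In A an element killed by gamma is a multiple of gamma, and
    modulo gamma the polynomial x^N - alpha is f^e.  Hence A consists of two
    copies of the same ring, A/gamma and gamma A, in which f is nilpotent of
    order exactly e ([two_layered]).  An ideal I of the theorem has two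
    invariants ([has_layers]): its image in A/gamma is generated by f^w, and its
    intersection with gamma A by gamma f^k.  The intersection of Ann(I) with
    gamma A is generated by gamma f^(e-w).  A monomial map preserves the number
    of words killed by gamma, so an isodual code has k = e - w
    ([isodual_layers]).  Conversely, if k = e - w and I I = 0, then I equals
    Ann(I) and the code is isodual through the reversal alone
    ([self_annihilating_isodual]).

    Exponents.  For G a unit, the number k attached to f^w + gamma f^t G is
    obtained by multiplying the generator by f^(e-w), which makes f^e appear.
    The binomial theorem gives f^e = 0 in characteristic p and
    f^e = gamma f^(p^(s-1)) U, with U a unit, in characteristic p^2 ([f_top]).
    So k = min(w, e - w + t) in the former case when G is a unit, k = w when
    G = 0, and k = min(w, p^(s-1)) in the latter case when G = 0.  All claims
    but one follow from these values together with I I = 0.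

    Characteristic 4, w = 2^(s-1).  Here I need not be its own annihilator.
    Put Z = x^(N/2).  The generator has the form P = Z + b + gamma y with
    b^2 = alpha, and P' = Z - b + gamma y satisfies
    P P' = Z^2 - b^2 = 0 because 2 gamma = 0; so Ann(P) = (P')
    ([annihilator_cofactor]).  Changing the sign of the first N/2 coordinates
    carries the code of P onto that of P' ([code_of_half_neg]). *)

Set Implicit Arguments.
Unset Strict Implicit.
Unset Printing Implicit Defensive.

Import GRing.Theory Pdiv.CommonRing Pdiv.RingMonic.
Local Open Scope ring_scope.

(** * Ideals and annihilators *)

Section Ideals.
Variable S : finComNzRingType.
Implicit Types (a b c x : S) (I : {set S}).

Lemma ideal_gen1P a x :
  reflect (exists c, x = c * a) (x \in ideal_gen [:: a]).
Proof.
rewrite inE; apply: (iffP existsP) => [[c /eqP->]|[c ->]].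
  by exists (c ord0); rewrite big_ord1.
by exists [ffun=> c]; rewrite big_ord1 ffunE.
Qed.

Lemma ideal_gen2P a b x :
  reflect (exists c d, x = c * a + d * b) (x \in ideal_gen [:: a; b]).
Proof.
rewrite inE; apply: (iffP existsP) => [[c /eqP->]|[c [d ->]]].
  by exists (c ord0), (c (lift ord0 ord0)); rewrite big_ord_recl big_ord1.
exists [ffun i => if i == ord0 then c else d].
by rewrite big_ord_recl big_ord1 !ffunE.
Qed.

Lemma ideal_gen_is_ideal (gs : seq S) : is_ideal (ideal_gen gs).
Proof.
split=> [|x y|a x]; rewrite !inE.
- apply/existsP; exists [ffun=> 0]; rewrite big1 // => i _.
  by rewrite ffunE mul0r.
- move=> /existsP[c /eqP->] /existsP[d /eqP->]; apply/existsP.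
  exists [ffun i => c i + d i]; rewrite -big_split; apply/eqP/eq_bigr => i _.
  by rewrite ffunE mulrDl.
- move=> /existsP[c /eqP->]; apply/existsP; exists [ffun i => a * c i].
  by rewrite mulr_sumr; apply/eqP/eq_bigr => i _; rewrite ffunE mulrA.
Qed.

Lemma is_idealB I a b : is_ideal I -> a \in I -> b \in I -> a - b \in I.
Proof.
by case=> _ ID IM aI bI; rewrite -mulN1r; apply: ID => //; apply: IM.
Qed.

Definition annihilator I := [set a | [forall b in I, a * b == 0]].

Lemma annihilatorP I a :
  reflect (forall b, b \in I -> a * b = 0) (a \in annihilator I).
Proof.
rewrite inE; apply: (iffP forall_inP) => H b bI; first exact/eqP/H.
exact/eqP/H.
Qed.

Lemma annihilator_is_ideal I : is_ideal (annihilator I).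
Proof.
split=> [|a b /annihilatorP Ha /annihilatorP Hb|c a /annihilatorP Ha];
  apply/annihilatorP => x xI.
- by rewrite mul0r.
- by rewrite mulrDl Ha // Hb // addr0.
- by rewrite -mulrA Ha // mulr0.
Qed.

End Ideals.

(** * Rings with two layers *)

(** What is used of R[x]/(x^(ne) - alpha): [layer_ann] says that multiplication
    by [g] identifies the quotient by [g] with the ideal of [g], and
    [layer_div] that, modulo [g], the annihilator of [f ^+ j] is generated by
    [f ^+ (e - j)], as in K[x]/(f^e). *)
Record two_layered (S : comNzRingType) (g f : S) (e : nat) : Prop := {
  layer_neq0 : g != 0;
  layer_ann : forall a, g * a = 0 <-> exists b, a = g * b;
  layer_top : g * f ^+ e = 0;
  layer_div : forall j a b, (j <= e)%N -> f ^+ j * a = g * b ->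
    exists c d, a = f ^+ (e - j) * c + g * d }.

Section TwoLayered.

Variables (S : finComNzRingType) (g f : S) (e : nat).
Hypothesis SL : two_layered g f e.
Implicit Types (a b c d x : S) (I : {set S}) (k l w : nat).

Lemma layer_sq a : g * (g * a) = 0.
Proof. by apply/(layer_ann SL); exists a. Qed.

Lemma layer_le0 k a : (e <= k)%N -> g * (f ^+ k * a) = 0.
Proof.
by move=> le; rewrite -(subnKC le) exprD -mulrA mulrA (layer_top SL) mul0r.
Qed.

(** The ideals generated by [g * f ^+ k], for [k <= e], strictly decrease: an
    equality would give [g * f ^+ e.-1 = 0], hence 1 would be a multiple of [f]
    modulo [g], although [f] is nilpotent modulo [g]. *)
Lemma layer_strict k l c :
  (k < e)%N -> g * f ^+ k = g * (f ^+ l * c) -> (l <= k)%N.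
Proof.
move=> lt_ke E; rewrite leqNgt; apply/negP => lt_kl.
(* Multiply the hypothesis by the missing power of [f]: a factor [f ^+ e]
   appears on the right. *)
have top0 : g * f ^+ e.-1 = 0.
  have -> : f ^+ e.-1 = f ^+ k * f ^+ (e.-1 - k).
    by rewrite -exprD; congr (_ ^+ _); lia.
  have -> : g * (f ^+ k * f ^+ (e.-1 - k)) = g * f ^+ k * f ^+ (e.-1 - k).
    by ring.
  rewrite E.
  have -> : g * (f ^+ l * c) * f ^+ (e.-1 - k)
          = g * (f ^+ (l + (e.-1 - k)) * c) by rewrite exprD; ring.
  by rewrite layer_le0 //; lia.
have /(layer_ann SL) [b fb] := top0.
have le_e1 : (e.-1 <= e)%N by lia.
have [|c' [d1]] := layer_div SL (a := 1) (b := b) le_e1.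
  by rewrite mulr1.
have -> : (e - e.-1 = 1)%N by lia.
rewrite expr1 => E1.
have gf : g = g * (f * c') by rewrite -[LHS]mulr1 E1 mulrDr layer_sq addr0.
(* [g] is thus fixed by the nilpotent [f * c']. *)
have gfn i : g = g * (f * c') ^+ i.
  by elim: i => [|i IH]; rewrite ?mulr1 // exprSr mulrA -IH.
have := layer_neq0 SL.
by rewrite (gfn e) exprMn layer_le0 // eqxx.
Qed.

(** For an ideal, the first two clauses say that its image modulo [g] is
    generated by [f ^+ w], the third that its intersection with the ideal of
    [g] is generated by [g * f ^+ k]. *)
Definition has_layers I w k : Prop :=
  [/\ forall a, a \in I -> exists c d, a = f ^+ w * c + g * d,
      exists d, f ^+ w + g * d \in I
    & forall a, g * a \in I <-> exists c, g * a = g * (f ^+ k * c)].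

(** Only the image of [I] modulo [g] matters, since [g] kills the multiples of
    [g]; and [f ^+ w] is killed, modulo [g], by the multiples of
    [f ^+ (e - w)]. *)
Lemma annihilator_layer I w k a : has_layers I w k -> (w <= e)%N ->
  g * a \in annihilator I <-> exists c, g * a = g * (f ^+ (e - w) * c).
Proof.
move=> [resI [d0 d0I] _] le_we; split=> [/annihilatorP Ha | [c ->]].
  have := Ha _ d0I.
  have -> : g * a * (f ^+ w + g * d0) = g * (f ^+ w * a) + g * (g * (a * d0)).
    by ring.
  rewrite layer_sq addr0.
  case/(layer_ann SL) => b /(layer_div SL le_we) [c [d ->]].
  by exists c; rewrite mulrDr layer_sq addr0.
apply/annihilatorP => b /resI[c' [d ->]].
have -> : g * (f ^+ (e - w) * c) * (f ^+ w * c' + g * d)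
  = g * (f ^+ (e - w) * f ^+ w * (c * c')) + g * (g * (f ^+ (e - w) * c * d)).
  by ring.
by rewrite layer_sq addr0 -exprD layer_le0 // subnK.
Qed.

(** An element of the annihilator kills [g * f ^+ k], hence is a multiple of
    [f ^+ w] modulo [g].  It differs by a multiple of [g] from an element of
    [I], and [annihilator_layer] puts this difference into [I]. *)
Lemma self_annihilating I w k :
  is_ideal I -> has_layers I w k -> (w <= e)%N -> k = (e - w)%N ->
  (forall a b, a \in I -> b \in I -> a * b = 0) -> annihilator I = I.
Proof.
move=> idI LI le_we Ek sq0; have [resI [d0 d0I] torI] := LI.
have [_ ID IM] := idI.
apply/setP => a; apply/idP/idP => [aJ|aI]; last first.
  by apply/annihilatorP => b bI; apply: sq0.
have gfkI : g * f ^+ k \in I by apply/torI; exists 1; rewrite mulr1.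
have /annihilatorP/(_ _ gfkI) := aJ.
have -> : a * (g * f ^+ k) = g * (f ^+ k * a) by ring.
have le_ke : (k <= e)%N by lia.
case/(layer_ann SL) => b /(layer_div SL le_ke) [c [d Ea]].
(* The element of [I] with the same image as [a] modulo [g]. *)
have iI : c * (f ^+ w + g * d0) \in I by exact: IM.
have iJ : c * (f ^+ w + g * d0) \in annihilator I.
  by apply/annihilatorP => x xI; apply: sq0.
have Ediff : a - c * (f ^+ w + g * d0) = g * (d - c * d0).
  rewrite Ea; have -> : (e - k = w)%N by lia.
  ring.
rewrite -(subrK (c * (f ^+ w + g * d0)) a); apply: ID => //.
rewrite Ediff; apply/torI; rewrite Ek.
apply/(annihilator_layer _ LI) => //; rewrite -Ediff.
exact: is_idealB (annihilator_is_ideal I) aJ iJ.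
Qed.

(** Both sets are generated by an element [g * f ^+ j], with [j = e - w] for
    the annihilator and [j = k] for [I]; these ideals form a strictly
    decreasing chain, so their cardinal determines [j]. *)
Lemma layers_of_card I w k :
  has_layers I w k -> (w <= e)%N -> (k <= e)%N ->
  #|[set a in annihilator I | g * a == 0]| = #|[set a in I | g * a == 0]| ->
  k = (e - w)%N.
Proof.
move=> LI le_we le_ke; have [_ _ torI] := LI.
pose lay j := [set g * (f ^+ j * c) | c : S].
have layE (J : {set S}) j :
    (forall a, g * a \in J <-> exists c, g * a = g * (f ^+ j * c)) ->
  [set a in J | g * a == 0] = lay j.
  move=> torJ; apply/setP => x; rewrite inE; apply/andP/imsetP.
    by case=> xJ /eqP/(layer_ann SL)[b Eb]; move: xJ;
      rewrite Eb => /torJ[c ->]; exists c.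
  by case=> c _ ->; rewrite layer_sq; split=> //; apply/torJ; exists c.
rewrite (layE (annihilator I) (e - w)%N) => [|a]; last first.
  exact: annihilator_layer LI le_we.
rewrite (layE I k) // => card_eq.
have lay_sub i j : (i <= j)%N -> lay j \subset lay i.
  move=> le; apply/subsetP => _ /imsetP[c _ ->]; apply/imsetP.
  by exists (f ^+ (j - i) * c); rewrite // [f ^+ i * _]mulrA -exprD subnKC.
have lay_inj i j : (i <= j <= e)%N -> #|lay i| = #|lay j| -> i = j.
  case/andP=> le_ij le_je cardE.
  have Eij : lay i = lay j.
    by apply/esym/eqP; rewrite eqEcard lay_sub //= cardE.
  have [||lt_ie] := ltngtP i e; [|by lia|by lia].
  have : g * f ^+ i \in lay j.
    by rewrite -Eij; apply/imsetP; exists 1; rewrite ?mulr1.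
  by case/imsetP => c _ /layer_strict; lia.
have [le|lt] := leqP k (e - w).
  by apply: lay_inj; rewrite ?card_eq //; lia.
by apply/esym/lay_inj; rewrite ?card_eq //; lia.
Qed.

(** If [c] times the generator is a multiple of [g], then [c] is a multiple of
    [f ^+ (e - w)] modulo [g]; the two generators of the lower layer are
    therefore [g] times the generator and [f ^+ (e - w)] times the generator. *)
Lemma layers_principal w l d U :
  (w <= e)%N -> f ^+ (e - w) * (f ^+ w + g * d) = g * (f ^+ l * U) ->
  (exists W, g * (U * W) = g) ->
  has_layers (ideal_gen [:: f ^+ w + g * d]) w (minn w l).
Proof.
move=> le_we Etop [W EW]; set gen := _ + _.
have gfw : g * f ^+ w = g * gen by rewrite mulrDr layer_sq addr0.
split=> [_ /ideal_gen1P[c ->]||a].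
- by exists c, (c * d); rewrite /gen; ring.
- by exists d; apply/ideal_gen1P; exists 1; rewrite mul1r.
split=> [/ideal_gen1P[c Ec]|[c ->]].
  have /(layer_div SL le_we)[c' [d' Ec']] : f ^+ w * c = g * (a - c * d).
    by rewrite mulrBr Ec /gen; ring.
  exists (f ^+ (w - minn w l) * d' + f ^+ (l - minn w l) * U * c').
  have -> : g * a = f ^+ (e - w) * gen * c' + g * gen * d'.
    by rewrite Ec Ec'; ring.
  have split_pow j : (minn w l <= j)%N ->
      f ^+ j = f ^+ minn w l * f ^+ (j - minn w l).
    by move=> le; rewrite -exprD subnKC.
  rewrite Etop -gfw (split_pow w (geq_minl w l)) (split_pow l (geq_minr w l)).
  ring.
apply/ideal_gen1P; have [le_wl|lt_lw] := leqP w l.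
  by exists (g * c); rewrite mulrAC -gfw; ring.
exists (f ^+ (e - w) * W * c).
have -> : f ^+ (e - w) * W * c * gen = f ^+ (e - w) * gen * (W * c) by ring.
rewrite Etop -[in LHS]EW; ring.
Qed.

Lemma layers_add w k mu d :
  has_layers (ideal_gen [:: f ^+ w + g * d]) w k -> (mu <= k)%N ->
  has_layers (ideal_gen [:: f ^+ w + g * d; g * f ^+ mu]) w mu.
Proof.
move=> [_ _ tor1] le_mk; split=> [_ /ideal_gen2P[c [c' ->]]||a].
- by exists c, (c * d + c' * f ^+ mu); ring.
- by exists d; apply/ideal_gen2P; exists 1, 0; rewrite mul1r mul0r addr0.
split=> [/ideal_gen2P[c [c' Ec]]|[c ->]]; last first.
  by apply/ideal_gen2P; exists 0, c; ring.
have [|x Ex] := (tor1 (a - c' * f ^+ mu)).1.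
  by apply/ideal_gen1P; exists c; rewrite mulrBr Ec; ring.
exists (f ^+ (k - mu) * x + c').
have -> : g * a = g * (a - c' * f ^+ mu) + g * (f ^+ mu * c') by ring.
by rewrite Ex -{1}(subnKC le_mk) exprD; ring.
Qed.

Lemma layers_gamma tau :
  has_layers (ideal_gen [:: g * f ^+ tau]) e tau.
Proof.
split=> [_ /ideal_gen1P[c ->]||a].
- by exists 0, (f ^+ tau * c); ring.
- have /(layer_ann SL)[b ->] := layer_top SL.
  by exists (- b); apply/ideal_gen1P; exists 0; ring.
split=> [/ideal_gen1P[c ->]|[c ->]]; first by exists c; ring.
by apply/ideal_gen1P; exists c; ring.
Qed.

(** Identifies the exponent [k] of the lower layer with the least [l] such that
    [g * f ^+ l] is in [I], the number kappa of the classification. *)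
Lemma layers_unique I w k l : has_layers I w k -> (k <= e)%N ->
  g * f ^+ l \in I -> (forall j, g * f ^+ j \in I -> (l <= j)%N) -> l = k.
Proof.
move=> [_ _ tor] le_ke glI minl.
have le_lk : (l <= k)%N by apply/minl/tor; exists 1; rewrite mulr1.
have [c Ec] := (tor _).1 glI.
have [lt_lk|] := ltnP l k; last by lia.
by have := layer_strict (leq_trans lt_lk le_ke) Ec; lia.
Qed.

End TwoLayered.

(** A unit plus a nilpotent is a unit, by the geometric series; here [f] is
    nilpotent after multiplication by [g]. *)
Lemma layer_unitD (S : finComNzRingType) (g f : S) (e k : nat) (a b y : S) :
  two_layered g f e -> g * (a * b) = g -> (0 < k)%N ->
  exists W, g * ((a + f ^+ k * y) * W) = g.
Proof.
move=> SL gab k_gt0; pose t := - (f ^+ k * y * b).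
exists (b * \sum_(i < e) t ^+ i).
have -> : g * ((a + f ^+ k * y) * (b * \sum_(i < e) t ^+ i))
  = g * (a * b) * (\sum_(i < e) t ^+ i) - g * t * (\sum_(i < e) t ^+ i).
  by rewrite /t; ring.
rewrite gab.
have -> : g * \sum_(i < e) t ^+ i - g * t * \sum_(i < e) t ^+ i
  = - g * ((t - 1) * \sum_(i < e) t ^+ i) by ring.
have gte : g * t ^+ e = 0.
  have -> : t ^+ e = f ^+ (k * e) * (- (y * b)) ^+ e.
    by rewrite exprM -exprMn /t; congr (_ ^+ _); ring.
  by apply: (layer_le0 SL); rewrite leq_pmull.
by rewrite -subrX1 mulrBr mulNr gte; ring.
Qed.

(** As for x^N - alpha = P P' in a polynomial ring.  The relation [u * P = 0]
    determines [u] modulo [g], up to a multiple of [P']; what remains is a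
    multiple of [g] killed by [P], hence by [f ^+ w], and the same argument
    applies to it. *)
Lemma annihilator_cofactor (S : finComNzRingType) (g f : S) (e w : nat)
    (a a' : S) : two_layered g f e -> (w <= e)%N ->
  (f ^+ w + g * a) * (f ^+ (e - w) + g * a') = 0 ->
  annihilator (ideal_gen [:: f ^+ w + g * a])
  = ideal_gen [:: f ^+ (e - w) + g * a'].
Proof.
move=> SL le_we; set P := f ^+ w + _; set P' := f ^+ (e - w) + _ => PP'.
apply/setP => u; apply/annihilatorP/ideal_gen1P => [uI|[c ->]]; last first.
  move=> _ /ideal_gen1P[d ->].
  have -> : c * P' * (d * P) = c * d * (P * P') by ring.
  by rewrite PP' mulr0.
have uP : u * P = 0 by apply: uI; apply/ideal_gen1P; exists 1; rewrite mul1r.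
have : f ^+ w * u = g * (- a * u).
  have -> : f ^+ w * u = u * P + g * (- a * u) by rewrite /P; ring.
  by rewrite uP add0r.
case/(layer_div SL le_we) => c [d Eu].
pose d' := d - a' * c.
have Eu' : u = P' * c + g * d' by rewrite Eu /P' /d'; ring.
have : g * (f ^+ w * d') = 0.
  have -> : g * (f ^+ w * d')
    = u * P - (P * P') * c - g * (g * (a * d')) by rewrite Eu' /P; ring.
  by rewrite uP PP' (layer_sq SL); ring.
case/(layer_ann SL) => b /(layer_div SL le_we)[c2 [d2 Ed]].
exists (c + g * c2).
have -> : u = P' * c + g * d' by [].
rewrite Ed.
have -> : P' * c + g * (f ^+ (e - w) * c2 + g * d2)
  = (c + g * c2) * P' + g * (g * d2) - g * (g * (a' * c2)).
  by rewrite /P'; ring.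
by rewrite !(layer_sq SL) addr0 subr0.
Qed.

(** * Words, ideals and duality *)

Section Quotient.
Variables (R : finComUnitRingType) (n e : nat) (alpha : R).
Local Notation N := (n * e)%N.
Local Notation A := (Ralpha n e alpha).
Local Notation toA := (to_Ralpha n e alpha).
Local Notation h := ('X^N - alpha%:P : {poly R}).

Lemma to_RalphaD p q : toA (p + q) = toA p + toA q.
Proof. exact: (rmorphD (in_qpoly h)). Qed.

Lemma to_RalphaB p q : toA (p - q) = toA p - toA q.
Proof. exact: (rmorphB (in_qpoly h)). Qed.

Lemma to_RalphaM p q : toA (p * q) = toA p * toA q.
Proof. exact: (rmorphM (in_qpoly h)). Qed.

Lemma to_RalphaX p k : toA (p ^+ k) = toA p ^+ k.
Proof. exact: (rmorphXn (in_qpoly h)). Qed.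

Lemma to_Ralpha0 : toA 0 = 0.
Proof. exact: (rmorph0 (in_qpoly h)). Qed.

Lemma to_Ralpha_nat k : toA k%:R = k%:R.
Proof. exact: (rmorph_nat (in_qpoly h)). Qed.

Hypothesis N_gt0 : (0 < N)%N.

Lemma monic_modulus : h \is monic.
Proof. exact: monicXnsubC. Qed.

Lemma mk_monic_modulus : mk_monic h = h.
Proof. by rewrite /mk_monic size_XnsubC // ltnS N_gt0 monic_modulus. Qed.

Definition poly_rep (a : A) : {poly R} := val a.

Lemma size_poly_rep (a : A) : (size (poly_rep a) <= N)%N.
Proof.
have size_h := congr1 (fun p : {poly R} => size p) mk_monic_modulus.
rewrite size_XnsubC // in size_h.
by rewrite -ltnS -size_h; exact: size_mk_monic.
Qed.

Lemma to_RalphaK (p : {poly R}) : (size p <= N)%N -> poly_rep (toA p) = p.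
Proof.
by move=> le; apply: in_qpoly_small; rewrite mk_monic_modulus size_XnsubC.
Qed.

Lemma poly_repK (a : A) : toA (poly_rep a) = a.
Proof. by apply/val_inj/to_RalphaK/size_poly_rep. Qed.

Lemma to_Ralpha_modulus : toA h = 0.
Proof.
apply/val_inj; rewrite /= mk_monic_modulus -[X in rmodp X]mul1r.
exact/rmodp_mull/monic_modulus.
Qed.

Lemma to_Ralpha_eq0 (p : {poly R}) : toA p = 0 -> exists c, p = c * h.
Proof.
move=> /(congr1 val) /=; rewrite mk_monic_modulus => E.
by exists (rdivp p h); rewrite {1}(rdivp_eq monic_modulus p) E addr0.
Qed.

Lemma to_RalphaXN : toA 'X^N = toA alpha%:P.
Proof.
apply/eqP; rewrite -subr_eq0 -to_RalphaB.
by rewrite -[X in X == _]/(toA h) to_Ralpha_modulus.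
Qed.

Definition elt_of (v : 'rV[R]_N) : A := toA (rVpoly v).
Definition word_of (a : A) : 'rV[R]_N := poly_rV (poly_rep a).

Lemma elt_ofK : cancel elt_of word_of.
Proof. by move=> v; rewrite /word_of to_RalphaK ?size_poly // rVpolyK. Qed.

Lemma word_ofK : cancel word_of elt_of.
Proof. by move=> a; rewrite /elt_of poly_rV_K ?poly_repK // size_poly_rep. Qed.

Lemma elt_ofD u v : elt_of (u + v) = elt_of u + elt_of v.
Proof. by rewrite /elt_of linearD to_RalphaD. Qed.

Lemma elt_ofZ c v : elt_of (c *: v) = toA c%:P * elt_of v.
Proof. by rewrite /elt_of linearZ /= -mul_polyC to_RalphaM. Qed.

Lemma elt_of0 : elt_of 0 = 0.
Proof. by rewrite /elt_of linear0 to_Ralpha0. Qed.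

(** The two sides differ by the leading coefficient times x^N - alpha, whose
    class is zero. *)
Lemma elt_of_shift c :
  elt_of (constacyclic_shift alpha c) = toA 'X * elt_of c.
Proof.
rewrite /elt_of -to_RalphaM; apply/esym/eqP; rewrite -subr_eq0 -to_RalphaB.
have lastP : (N.-1 < N)%N by rewrite prednK.
suff -> : 'X * rVpoly c - rVpoly (constacyclic_shift alpha c)
     = (c 0 (Ordinal lastP))%:P * h.
  by rewrite to_RalphaM to_Ralpha_modulus mulr0.
have coefc j (lt : (j < N)%N) : (rVpoly c)`_j = c 0 (Ordinal lt).
  by rewrite -(coef_rVpoly_ord c (Ordinal lt)).
apply/polyP => i; rewrite coefB coefXM coefCM coefB coefXn coefC.
have [lt_iN|le_Ni] := ltnP i N; last first.
  rewrite [(rVpoly (constacyclic_shift _ _))`_i]nth_default; last first.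
    by rewrite (leq_trans (size_poly _ _)).
  have -> : (i == 0) = false by apply/eqP; lia.
  rewrite !subr0; have [->|neq] := eqVneq i N; last first.
    rewrite mulr0 nth_default // (leq_trans (size_poly _ _)) //; lia.
  by rewrite mulr1 -coefc.
rewrite -[in X in _ - X]/(nat_of_ord (Ordinal lt_iN)) coef_rVpoly_ord mxE /=.
have -> : (i == N) = false by apply/eqP; lia.
have [i0|i0] := eqVneq i 0.
  rewrite !sub0r mulrN mulrC; congr (- (c _ _ * _)).
  by apply: val_inj => /=; rewrite i0 add0n modn_small //; lia.
rewrite mul1r subr0 mulr0.
have lt : (i.-1 < N)%N by lia.
rewrite (coefc _ lt); apply/eqP; rewrite subr_eq0; apply/eqP; congr (c _ _).
apply: val_inj => /=.
have -> : (i + N).-1 = (i.-1 + N)%N by lia.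
by rewrite modnDr modn_small.
Qed.

Lemma mem_code_of (I : {set A}) v : (v \in code_of I) = (elt_of v \in I).
Proof. by rewrite inE. Qed.

Lemma code_of_constacyclic (I : {set A}) :
  is_ideal I -> constacyclic alpha (code_of I).
Proof.
case=> I0 ID IM; split; first split.
- by rewrite mem_code_of elt_of0.
- by move=> u v; rewrite !mem_code_of elt_ofD; apply: ID.
- by move=> c v; rewrite !mem_code_of elt_ofZ; apply: IM.
- by move=> c; rewrite !mem_code_of elt_of_shift; apply: IM.
Qed.

Definition rev_word (v : 'rV[R]_N) : 'rV[R]_N := \row_i v 0 (rev_ord i).

Lemma rev_wordK : involutive rev_word.
Proof. by move=> v; apply/rowP => i; rewrite !mxE rev_ordK. Qed.

(** The product of two polynomials of degree less than N has degree at most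
    2N - 2, so the reduction modulo x^N - alpha leaves the coefficient of
    x^(N-1) unchanged; this coefficient is a convolution, which the reversal
    of one factor turns into an inner product. *)
Lemma coef_dot u c :
  (poly_rep (elt_of c * elt_of (rev_word u)))`_N.-1 = \sum_i u 0 i * c 0 i.
Proof.
rewrite /elt_of -to_RalphaM.
set P := rVpoly c * _.
have sP : (size P <= N + N.-1)%N.
  rewrite (leq_trans (size_polyMleq _ _)) //.
  have size_rV (v : 'rV[R]_N) : (size (rVpoly v) <= N)%N by exact: size_poly.
  by have := size_rV c; have := size_rV (rev_word u); lia.
have sdrop : (size (drop_poly N P) <= N.-1)%N.
  by rewrite size_drop_poly; lia.
have -> : toA P = toA (take_poly N P + alpha%:P * drop_poly N P).
  rewrite -[in LHS](poly_take_drop N P) !to_RalphaD !to_RalphaM to_RalphaXN.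
  by rewrite mulrC.
rewrite to_RalphaK; last first.
  rewrite (leq_trans (size_polyD _ _)) // geq_max size_take_poly mul_polyC.
  by rewrite (leq_trans (size_scale_leq _ _)) // (leq_trans sdrop) // leq_pred.
rewrite coefD coef_take_poly ltn_predL N_gt0 coefCM.
rewrite [(drop_poly _ _)`_ _]nth_default // mulr0 addr0 coefM prednK //.
apply: eq_bigr => i _; rewrite coef_rVpoly_ord mulrC; congr (_ * _).
have -> : (N.-1 - i)%N = nat_of_ord (rev_ord i) by rewrite /=; lia.
by rewrite coef_rVpoly_ord mxE rev_ordK.
Qed.

(** One inclusion is [coef_dot].  For the other, if [u] is in the dual and [b]
    in the ideal, the reversal of [u] times [b] has zero top coefficient after
    multiplication by any ring element; letting this element run through the
    powers of x shows that all its coefficients vanish. *)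
Lemma dual_code_of (I : {set A}) : is_ideal I ->
  dual_code (code_of I) = rev_word @: code_of (annihilator I).
Proof.
case=> I0 ID IM; rewrite -[RHS]/(_ @: _).
have -> : rev_word @: code_of (annihilator I)
        = [set u | elt_of (rev_word u) \in annihilator I].
  apply/setP => u; rewrite inE; apply/imsetP/idP => [[v vI ->]|uI].
    by rewrite rev_wordK -mem_code_of.
  by exists (rev_word u); rewrite ?mem_code_of ?rev_wordK.
apply/setP => u; rewrite !inE; apply/forall_inP/forall_inP => [H b bI|H c].
  set a := _ * b; pose v := rev_word (word_of a).
  have Ea : elt_of (rev_word v) = a by rewrite rev_wordK word_ofK.
  suff v0 : v = 0.
    rewrite -Ea v0 (_ : rev_word 0 = 0) ?elt_of0 //.
    by apply/rowP => i; rewrite !mxE.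
  apply/rowP => i; rewrite [RHS]mxE.
  have := coef_dot v (delta_mx 0 i); rewrite Ea.
  rewrite (bigD1 i) //= big1 => [|j neq]; last first.
    by rewrite [delta_mx _ _ _ _]mxE (negPf neq) andbF mulr0.
  rewrite [delta_mx _ _ _ _]mxE !eqxx mulr1 addr0 => <-.
  have -> : elt_of (delta_mx 0 i) * a
    = elt_of (word_of (elt_of (delta_mx 0 i) * b)) * elt_of (rev_word u).
    by rewrite word_ofK /a; ring.
  rewrite coef_dot; apply/eqP/H.
  by rewrite mem_code_of word_ofK; apply: IM.
rewrite mem_code_of => cI; rewrite -coef_dot mulrC (eqP (H _ cI)).
by rewrite coef0.
Qed.

Definition rev_perm : 'S_N := perm (@rev_ord_inj N).

(** It suffices to find a diagonal map between the code of the ideal and that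
    of its annihilator: the reversal supplies the permutation. *)
Lemma isodual_of_annihilator (I : {set A}) (d : 'I_N -> R) :
  is_ideal I -> (forall i, d i \is a GRing.unit) ->
  code_of (annihilator I) = monomial_map 1 d @: code_of I ->
  isodual (code_of I).
Proof.
move=> idI d_unit E; exists rev_perm, (d \o @rev_ord N).
split=> [i|]; first exact: d_unit.
rewrite dual_code_of // E -imset_comp; apply: eq_imset => c.
by apply/rowP => i; rewrite !mxE perm1 permE.
Qed.

Lemma isodual_self_annihilating (I : {set A}) :
  is_ideal I -> annihilator I = I -> isodual (code_of I).
Proof.
move=> idI E; apply: (@isodual_of_annihilator I (fun=> 1)) => // [i|].
  exact: unitr1.
rewrite E -[LHS]imset_id; apply: eq_imset => c; apply/rowP => i.
by rewrite mxE perm1 mul1r.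
Qed.

(** Monomial maps and the reversal are bijections that commute with the
    multiplication by [gamma]. *)
Lemma isodual_card (gamma : R) (I : {set A}) :
  let g : A := toA gamma%:P in is_ideal I -> isodual (code_of I) ->
  #|[set a in annihilator I | g * a == 0]| = #|[set a in I | g * a == 0]|.
Proof.
move=> g idI [sigma [d [d_unit E]]].
have cardE (J : {set A}) : #|[set a in J | g * a == 0]|
    = #|[set c in code_of J | gamma *: c == 0]|.
  rewrite -(card_imset _ (can_inj elt_ofK)); apply: eq_card => a.
  apply/idP/imsetP => [|[c]]; rewrite !inE.
    case/andP=> aJ /eqP ga; exists (word_of a); last by rewrite word_ofK.
    rewrite !inE -/(elt_of _) word_ofK aJ /=.
    by rewrite -(inj_eq (can_inj elt_ofK)) elt_of0 elt_ofZ word_ofK ga.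
  rewrite -/(elt_of _) => /andP[cJ /eqP gc] ->; rewrite cJ /=.
  by rewrite -elt_ofZ gc elt_of0.
have card_inj (C : {set 'rV[R]_N}) (F : 'rV[R]_N -> 'rV[R]_N) :
    injective F -> (forall c, (gamma *: F c == 0) = (gamma *: c == 0)) ->
  #|[set c in F @: C | gamma *: c == 0]| = #|[set c in C | gamma *: c == 0]|.
  move=> F_inj F0; rewrite -[RHS](card_imset _ F_inj); apply: eq_card => c.
  apply/idP/imsetP => [|[b]]; rewrite !inE.
    case/andP=> /imsetP[b bC ->]; rewrite F0 => gb.
    by exists b; rewrite // inE bC.
  by case/andP=> bC gb ->; rewrite F0 gb andbT imset_f.
rewrite !cardE -(card_inj (code_of (annihilator I)) rev_word).
- rewrite -dual_code_of // E; apply: card_inj => [b c|c].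
    move=> /rowP eq_bc; apply/rowP => i.
    have := eq_bc (sigma^-1 i)%g; rewrite !mxE permKV.
    exact: (mulrI (d_unit _)).
  apply/eqP/eqP => /rowP c0; apply/rowP => i.
    have := c0 (sigma^-1 i)%g; rewrite !mxE permKV mulrCA.
    by rewrite -[X in _ = X](mulr0 (d (sigma^-1 i)%g)) => /(mulrI (d_unit _)).
  by have := c0 (sigma i); rewrite !mxE mulrCA => ->; rewrite mulr0.
- exact: (can_inj rev_wordK).
move=> c; apply/eqP/eqP => /rowP c0; apply/rowP => i.
  by have := c0 (rev_ord i); rewrite !mxE rev_ordK.
by have := c0 (rev_ord i); rewrite !mxE.
Qed.

End Quotient.

(** * The binomial theorem modulo a prime and its square *)

Section Frobenius.
Variables (S : comNzRingType) (p : nat).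
Hypothesis p_prime : prime p.
Implicit Types (a b : S).

(** The term of degree one in [a] is kept apart: its binomial coefficient is
    exactly [p], and in [exprD_prime_pow_sq] it gives the lowest power of [a]
    among the terms divisible by [p]. *)
Lemma exprD_prime a b : exists y,
  (a + b) ^+ p = a ^+ p + b ^+ p + p%:R * (a * b ^+ p.-1 + a ^+ 2 * y).
Proof.
have [q Ep] : exists q, p = q.+2.
  by exists p.-2; have := prime_gt1 p_prime; lia.
have pr_q : prime q.+2 by rewrite -Ep.
rewrite Ep /=.
exists (\sum_(i < q)
  a ^+ (q - i.+1) * b ^+ i.+1 *+ ('C(q.+2, i.+1) %/ q.+2)).
rewrite exprDn big_ord_recl big_ord_recr big_ord_recr /= /bump /= !add1n.
rewrite subn0 expr0 mulr1 bin0 mulr1n subnn expr0 mul1r binn mulr1n.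
rewrite binSn subSnn expr1 -addrA addrA mulrDr.
have -> : \sum_(i < q)
    (a ^+ (q.+2 - (1 + i)) * b ^+ (1 + i)) *+ 'C(q.+2, 1 + i)
  = q.+2%:R * (a ^+ 2 * \sum_(i < q)
      a ^+ (q - i.+1) * b ^+ i.+1 *+ ('C(q.+2, i.+1) %/ q.+2)).
  rewrite !mulr_sumr; apply: eq_bigr => i _; rewrite add1n.
  have dv : (q.+2 %| 'C(q.+2, i.+1))%N.
    by apply: prime_dvd_bin => //; have := ltn_ord i; lia.
  have -> : (q.+2 - i.+1 = 2 + (q - i.+1))%N by have := ltn_ord i; lia.
  have -> (x : S) :
      x *+ 'C(q.+2, i.+1) = q.+2%:R * (x *+ ('C(q.+2, i.+1) %/ q.+2)).
    by rewrite mulr_natl -mulrnA divnK.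
  by rewrite exprD -mulrA !mulrnAr.
rewrite -(mulr_natl (a * _)).
set P := q.+2%:R; set Q := \sum_(i < q) _.
ring.
Qed.

Lemma exprD_prime_pow a b k : exists y,
  (a + b) ^+ (p ^ k) = a ^+ (p ^ k) + b ^+ (p ^ k) + p%:R * y.
Proof.
elim: k => [|k [y Ey]]; first by exists 0; rewrite expn0 !expr1 mulr0 addr0.
rewrite expnSr !exprM Ey addrC.
have [y1 ->] := exprD_prime (p%:R * y) (a ^+ (p ^ k) + b ^+ (p ^ k)).
have [y2 ->] := exprD_prime (a ^+ (p ^ k)) (b ^+ (p ^ k)).
have Ep : p = p.-1.+1 by rewrite prednK ?prime_gt0.
set A := a ^+ _; set B := b ^+ _.
exists (y * (p%:R * y) ^+ p.-1 + (A * B ^+ p.-1 + A ^+ 2 * y2)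
        + (p%:R * y * (A + B) ^+ p.-1 + (p%:R * y) ^+ 2 * y1)).
have -> : (p%:R * y) ^+ p = p%:R * (y * (p%:R * y) ^+ p.-1).
  by rewrite {2}Ep exprS; ring.
ring.
Qed.

(** The error term of the first [k] steps is a multiple of [p]; it disappears
    at the last step, which multiplies it by [p] again. *)
Lemma exprD_prime_pow_sq a b k : (p%:R : S) ^+ 2 = 0 -> exists y,
  (a + b) ^+ (p ^ k.+1) = a ^+ (p ^ k.+1) + b ^+ (p ^ k.+1)
    + p%:R * (a ^+ (p ^ k) * (b ^+ (p ^ k)) ^+ p.-1 + (a ^+ (p ^ k)) ^+ 2 * y).
Proof.
move=> p2; have [y Ey] := exprD_prime_pow a b k.
rewrite expnSr !exprM Ey addrC.
set A := a ^+ _; set B := b ^+ _.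
have [y1 ->] := exprD_prime (p%:R * y) (A + B).
have [y2 ->] := exprD_prime A B; exists y2.
have -> : (p%:R * y) ^+ p = 0.
  rewrite -[X in _ ^+ X](subnKC (prime_gt1 p_prime)) exprD exprMn p2.
  by rewrite !mul0r.
have -> : p%:R * (p%:R * y * (A + B) ^+ p.-1 + (p%:R * y) ^+ 2 * y1)
  = p%:R ^+ 2 * (y * (A + B) ^+ p.-1 + p%:R * y ^+ 2 * y1) by ring.
rewrite p2; ring.
Qed.

End Frobenius.

(** * The chain ring and its constacyclic quotient *)

Section ChainRing.
Variables (R : finComUnitRingType) (gamma : R).
Hypothesis gamma_max : maximal_ideal (ideal_gen [:: gamma]).
Hypothesis gamma_neq0 : gamma != 0.
Hypothesis gamma_sq : gamma ^+ 2 = 0.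

(** Either [r] is in the maximal ideal or [gamma] and [r] generate 1; in the
    latter case [r] is invertible up to the annihilator of [gamma]. *)
Lemma gamma_dichotomy (r : R) :
  (exists b, r = gamma * b) \/ (exists c, gamma = gamma * (r * c)).
Proof.
case: gamma_max => _ _ /(_ (ideal_gen [:: gamma; r])) [||E|E].
- exact: ideal_gen_is_ideal.
- apply/subsetP => _ /ideal_gen1P[c ->]; apply/ideal_gen2P.
  by exists c, 0; rewrite mul0r addr0.
- left; have : r \in ideal_gen [:: gamma].
    by rewrite -E; apply/ideal_gen2P; exists 0, 1; rewrite mul0r mul1r add0r.
  by case/ideal_gen1P => c ->; exists c; rewrite mulrC.
right; have : 1 \in ideal_gen [:: gamma; r] by rewrite E inE.
case/ideal_gen2P => c [d E1]; exists d.
have -> : gamma * (r * d) = gamma * (c * gamma + d * r) - c * gamma ^+ 2.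
  by ring.
by rewrite -E1 gamma_sq mulr0 subr0 mulr1.
Qed.

Lemma gamma_annP (a : R) : gamma * a = 0 <-> exists b, a = gamma * b.
Proof.
split=> [ga|[b ->]]; last by rewrite mulrA -expr2 gamma_sq mul0r.
case: (gamma_dichotomy a) => // -[c Ec].
by move: gamma_neq0; rewrite Ec mulrA ga mul0r eqxx.
Qed.

Lemma nilpotent_in_gamma (r : R) : r ^+ 2 = 0 -> exists b, r = gamma * b.
Proof.
move=> r2; case: (gamma_dichotomy r) => // -[c Ec].
move: gamma_neq0; rewrite Ec {1}Ec.
have -> : gamma * (r * c) * (r * c) = gamma * r ^+ 2 * c ^+ 2 by ring.
by rewrite r2 mulr0 mul0r eqxx.
Qed.

Lemma poly_gamma_annP (q : {poly R}) :
  gamma%:P * q = 0 -> exists q', q = gamma%:P * q'.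
Proof.
move=> gq; pose div (a : R) := odflt 0 [pick b | a == gamma * b].
have divE a : gamma * a = 0 -> gamma * div a = a.
  case/gamma_annP => b Eb; rewrite /div; case: pickP => [c /eqP //|/(_ b)].
  by rewrite Eb eqxx.
exists (\poly_(i < size q) div q`_i); apply/polyP => i.
rewrite coefCM coef_poly; case: ltnP => [_|le]; last first.
  by rewrite mulr0 nth_default.
by rewrite divE // -coefCM gq coef0.
Qed.

Section Layers.
Variables (n e : nat) (alpha0 alpha : R).
Hypotheses (n_gt0 : (0 < n)%N) (e_gt0 : (0 < e)%N).
Hypothesis modulus_split : exists v : {poly R},
  ('X^n - alpha0%:P) ^+ e = 'X^(n * e) - alpha%:P + gamma%:P * v.

Local Notation A := (Ralpha n e alpha).
Local Notation g := (gammaR gamma n e alpha).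
Local Notation f := (fR n e alpha0 alpha).
Local Notation toA := (to_Ralpha n e alpha).

Let N_gt0 : (0 < n * e)%N. Proof. by rewrite muln_gt0 n_gt0. Qed.

(** By [modulus_split], [f ^+ e] vanishes modulo [gamma].  For [layer_div], lift
    the equation to R[x]: modulo [gamma] it becomes a multiple of
    [f ^+ j], which is monic and can be cancelled. *)
Lemma Ralpha_two_layered : two_layered g f e.
Proof.
have gC (c : {poly R}) : gamma%:P * (gamma%:P * c) = 0.
  by rewrite mulrA -polyCM -expr2 gamma_sq mul0r.
have [v Ev] := modulus_split.
split.
- apply/eqP => /(congr1 (@poly_rep R n e alpha)).
  rewrite to_RalphaK // ?size_polyC; last by case: eqP.
  by move/eqP; rewrite polyC_eq0 (negPf gamma_neq0).
- move=> a; split=> [ga|[b ->]]; last first.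
    by rewrite mulrA /gammaR -to_RalphaM -polyCM -expr2 gamma_sq
      to_Ralpha0 mul0r.
  have small : (size (gamma%:P * poly_rep a)%R <= n * e)%N.
    by rewrite mul_polyC (leq_trans (size_scale_leq _ _)) ?size_poly_rep.
  have : gamma%:P * poly_rep a = 0.
    rewrite -(to_RalphaK alpha N_gt0 small) to_RalphaM poly_repK //.
    by rewrite -[to_Ralpha _ _ _ _]/g ga.
  case/poly_gamma_annP => q Eq; exists (toA q).
  by rewrite -[a]poly_repK // Eq to_RalphaM.
- rewrite /f /g -to_RalphaX -to_RalphaM Ev mulrDr gC addr0.
  by rewrite to_RalphaM to_Ralpha_modulus // mulr0.
move=> j a b le_je E.
have f_monic : 'X^n - alpha0%:P \is monic by exact: monicXnsubC.
have : toA (('X^n - alpha0%:P) ^+ j * poly_rep a - gamma%:P * poly_rep b) = 0.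
  rewrite to_RalphaB !to_RalphaM to_RalphaX !poly_repK //.
  by rewrite -[to_Ralpha _ _ _ gamma%:P]/g -[to_Ralpha _ _ _ _]/f E subrr.
case/to_Ralpha_eq0 => // c Ec.
have E2 : ('X^n - alpha0%:P) ^+ j *
    (gamma%:P * (poly_rep a - ('X^n - alpha0%:P) ^+ (e - j) * c)) = 0.
  have -> : ('X^n - alpha0%:P) ^+ j *
      (gamma%:P * (poly_rep a - ('X^n - alpha0%:P) ^+ (e - j) * c)) =
    gamma%:P * (('X^n - alpha0%:P) ^+ j * poly_rep a - gamma%:P * poly_rep b)
    + gamma%:P * (gamma%:P * poly_rep b)
    - gamma%:P *
      ((('X^n - alpha0%:P) ^+ j * ('X^n - alpha0%:P) ^+ (e - j)) * c).
    by ring.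
  rewrite -exprD subnKC // Ev Ec gC addr0.
  have -> : gamma%:P * (c * ('X^(n * e) - alpha%:P)) -
    gamma%:P * (('X^(n * e) - alpha%:P + gamma%:P * v) * c)
    = - (gamma%:P * (gamma%:P * (v * c))) by ring.
  by rewrite gC oppr0.
(* A monic polynomial is regular, although R has zero divisors. *)
have fj_monic : ('X^n - alpha0%:P) ^+ j \is monic by exact: monic_exp.
have /poly_gamma_annP[q Eq] :
    gamma%:P * (poly_rep a - ('X^n - alpha0%:P) ^+ (e - j) * c) = 0.
  by apply: (monic_lreg fj_monic); rewrite E2 mulr0.
exists (toA c), (toA q).
rewrite -[a]poly_repK //.
rewrite -[poly_rep a](subrK (('X^n - alpha0%:P) ^+ (e - j) * c)) Eq.
by rewrite to_RalphaD !to_RalphaM to_RalphaX addrC.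
Qed.

End Layers.
End ChainRing.

(** * Changing the sign of half of the coordinates *)

Section HalfNegation.
Variables (R : finComUnitRingType) (gamma : R) (n e H : nat) (alpha beta : R).
Local Notation N := (n * e)%N.
Local Notation A := (Ralpha n e alpha).
Local Notation toA := (to_Ralpha n e alpha).
Local Notation g := (gammaR gamma n e alpha).
Hypotheses (N_gt0 : (0 < N)%N) (N_half : N = (H + H)%N).
Hypotheses (beta_sq : beta ^+ 2 = alpha) (gamma2 : gamma *+ 2 = 0).
Hypothesis gamma_sq : gamma ^+ 2 = 0.

Definition half_sign (i : 'I_N) : R := if (i < H)%N then -1 else 1.

Local Notation theta := (monomial_map (1 : 'S_N) half_sign).

Lemma half_neg_poly (v : 'rV[R]_N) :
  rVpoly (theta v) = rVpoly v - take_poly H (rVpoly v) *+ 2.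
Proof.
apply/polyP => i; rewrite coefB coefMn coef_take_poly.
have [lt|le] := ltnP i N; last first.
  have coef0 (u : 'rV[R]_N) : (rVpoly u)`_i = 0.
    by rewrite nth_default // (leq_trans (size_poly _ _)).
  by rewrite !coef0 if_same mul0rn subr0.
rewrite -[i]/(nat_of_ord (Ordinal lt)) !coef_rVpoly_ord mxE perm1 /half_sign.
by case: ifP => _; ring.
Qed.

Lemma half_negK : involutive theta.
Proof.
move=> v; apply/rowP => i; rewrite !mxE !perm1 /half_sign.
by case: ifP => _; ring.
Qed.

(** Write a multiple of [Z + b + g * w] as [c' * (Z + b)] plus a multiple of
    [g], with [c'] of degree less than [H]; this is possible because
    [Z * (Z + b) = b * (Z + b)].  The two halves of the word are then [b * c']
    and [c'] up to multiples of [g], which are equal to their opposites as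
    [2 * gamma = 0]; the change of sign produces [c' * (Z - b)]. *)
Lemma half_neg_mem (w : A) (v : 'rV[R]_N) :
  let Z : A := toA 'X^H in let b : A := toA beta%:P in
  elt_of alpha v \in ideal_gen [:: Z + b + g * w] ->
  elt_of alpha (theta v) \in ideal_gen [:: Z - b + g * w].
Proof.
move=> Z b /ideal_gen1P[c Ec].
have gg : g ^+ 2 = 0.
  by rewrite -to_RalphaX -polyC_exp gamma_sq to_Ralpha0.
have ZZ : Z ^+ 2 = b ^+ 2.
  by rewrite -!to_RalphaX -exprM muln2 -addnn -N_half to_RalphaXN // -polyC_exp
    beta_sq.
pose c0 := take_poly H (poly_rep c); pose c1 := drop_poly H (poly_rep c).
have Cc : c = toA c0 + Z * toA c1.
  rewrite -[LHS](poly_repK N_gt0) -(poly_take_drop H (poly_rep c)).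
  by rewrite to_RalphaD to_RalphaM (mulrC _ Z).
have [c' [c'E sc']] : exists c' : {poly R},
    toA c' = toA c0 + b * toA c1 /\ (size c' <= H)%N.
  exists (c0 + beta%:P * c1); rewrite to_RalphaD to_RalphaM; split=> //.
  rewrite (leq_trans (size_polyD _ _)) // geq_max size_take_poly mul_polyC.
  rewrite (leq_trans (size_scale_leq _ _)) // size_drop_poly leq_subLR.
  by rewrite -N_half size_poly_rep.
have Ev : elt_of alpha v = toA c' * (Z + b) + g * (w * c).
  have -> : toA c' * (Z + b) = c * (Z + b) + toA c1 * (b ^+ 2 - Z ^+ 2).
    by rewrite Cc c'E; ring.
  by rewrite Ec ZZ; ring.
have rV : rVpoly v = beta%:P * c' + c' * 'X^H + gamma%:P * poly_rep (w * c).
  rewrite -[LHS](to_RalphaK alpha N_gt0) ?size_poly // -/(elt_of _ v) Ev.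
  have -> : toA c' * (Z + b) + g * (w * c)
      = toA (beta%:P * c' + c' * 'X^H + gamma%:P * poly_rep (w * c)).
    by rewrite !to_RalphaD !to_RalphaM poly_repK // -/b -/Z /gammaR; ring.
  rewrite to_RalphaK //.
  rewrite (leq_trans (size_polyD _ _)) // geq_max; apply/andP; split.
    rewrite (leq_trans (size_polyD _ _)) // geq_max; apply/andP; split.
      by rewrite mul_polyC (leq_trans (size_scale_leq _ _)) //; lia.
    by rewrite (leq_trans (size_polyMleq _ _)) // size_polyXn; lia.
  by rewrite mul_polyC (leq_trans (size_scale_leq _ _)) ?size_poly_rep.
have sbc' : (size (beta%:P * c')%R <= H)%N.
  by rewrite mul_polyC (leq_trans (size_scale_leq _ _)).
have take2 : take_poly H (rVpoly v) *+ 2 = (beta%:P * c') *+ 2.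
  rewrite rV !take_polyD take_polyMXn_0 addr0 (take_poly_id sbc').
  rewrite (mul_polyC gamma) take_polyZ mulrnDl scalerMnl gamma2.
  by rewrite scale0r addr0.
have -> : elt_of alpha (theta v) = elt_of alpha v - (b * toA c') *+ 2.
  rewrite {1}/elt_of half_neg_poly to_RalphaB take2 -/(elt_of _ v).
  by rewrite !mulr2n to_RalphaD to_RalphaM.
rewrite Ev; apply/ideal_gen1P; exists (toA c' + g * (w * toA c1)).
have cE : c = toA c' + (Z - b) * toA c1 by rewrite Cc c'E; ring.
rewrite cE.
have -> : (toA c' + g * (w * toA c1)) * (Z - b + g * w)
  = toA c' * (Z + b) + g * (w * (toA c' + (Z - b) * toA c1))
    - b * toA c' *+ 2 + g ^+ 2 * (w ^+ 2 * toA c1) by ring.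
by rewrite gg mul0r addr0.
Qed.

End HalfNegation.

Lemma code_of_half_neg (R : finComUnitRingType) (gamma : R) (n e H : nat)
    (alpha beta : R) (w : Ralpha n e alpha) :
  let Z := to_Ralpha n e alpha 'X^H in
  let b := to_Ralpha n e alpha beta%:P in
  let g := gammaR gamma n e alpha in
  (0 < n * e)%N -> (n * e = H + H)%N -> beta ^+ 2 = alpha ->
  gamma *+ 2 = 0 -> gamma ^+ 2 = 0 ->
  code_of (ideal_gen [:: Z - b + g * w])
  = monomial_map 1 (half_sign R H) @: code_of (ideal_gen [:: Z + b + g * w]).
Proof.
move=> Z b g N_gt0 N_half beta_sq gamma2 gamma_sq.
have bN : to_Ralpha n e alpha (- beta)%:P = - b.
  by rewrite polyCN -sub0r to_RalphaB to_Ralpha0 sub0r.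
apply/setP => u; apply/idP/imsetP => [uJ|[v vI ->]].
  exists (monomial_map 1 (half_sign R H) u); last by rewrite half_negK.
  rewrite mem_code_of.
  have := @half_neg_mem R gamma n e H alpha (- beta) N_gt0 N_half _ gamma2
    gamma_sq w u.
  by rewrite sqrrN /= bN opprK -mem_code_of; apply.
rewrite mem_code_of; apply: half_neg_mem => //.
by rewrite -mem_code_of.
Qed.

(** * Isodual codes from the layers of an ideal *)

Section Isodual.
Variables (R : finComUnitRingType) (gamma : R) (n e : nat) (alpha0 alpha : R).
Local Notation A := (Ralpha n e alpha).
Local Notation g := (gammaR gamma n e alpha).
Local Notation f := (fR n e alpha0 alpha).
Local Notation genGA := (@genG R gamma n e alpha0 alpha).
Local Notation isIII T := (@typeIII R gamma T n e alpha0 alpha).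
Local Notation isIV T := (@typeIV R gamma T n e alpha0 alpha).
Hypotheses (N_gt0 : (0 < n * e)%N) (SL : two_layered g f e).

Lemma isodual_layers (I : {set A}) w k :
  is_ideal I -> has_layers g f I w k -> (w <= e)%N -> (k <= e)%N ->
  isodual (code_of I) -> k = (e - w)%N.
Proof.
move=> idI LI le_we le_ke iso; apply: (layers_of_card SL LI) => //.
exact: isodual_card.
Qed.

Lemma self_annihilating_isodual (I : {set A}) w k :
  is_ideal I -> has_layers g f I w k -> (w <= e)%N -> k = (e - w)%N ->
  (forall a b, a \in I -> b \in I -> a * b = 0) ->
  isodual_constacyclic alpha (code_of I).
Proof.
move=> idI LI le_we Ek sq0; split; first exact: code_of_constacyclic.
apply: isodual_self_annihilating => //; exact: (self_annihilating SL idI LI).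
Qed.

Lemma is_kappa_layers (x : A) w k : (k <= e)%N ->
  has_layers g f (ideal_gen [:: x]) w k -> is_kappa gamma alpha0 x k.
Proof.
move=> le_ke [_ _ tor]; split; first by apply/tor; exists 1; rewrite mulr1.
move=> j /tor[c Ec]; rewrite leqNgt; apply/negP => lt_jk.
have := layer_strict SL (leq_trans lt_jk le_ke) Ec.
by rewrite leqNgt lt_jk.
Qed.

Lemma typeII_isodual (C : {set 'rV[R]_(n * e)}) :
  (typeII gamma alpha0 alpha C /\ isodual_constacyclic alpha C) <->
  C = code_of (ideal_gen [:: g]).
Proof.
have e_gt0 : (0 < e)%N by case: e N_gt0 => //; rewrite muln0.
split=> [[[tau [lt_te ->]] [_ iso]]|->].
  have le_te : (tau <= e)%N by lia.
  have := isodual_layers (ideal_gen_is_ideal _) (layers_gamma SL tau)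
    (leqnn e) le_te iso.
  by rewrite subnn => ->; rewrite expr0 mulr1.
split; first by exists 0%N; rewrite expr0 mulr1.
apply: (self_annihilating_isodual (w := e) (k := 0)) => //.
- exact: ideal_gen_is_ideal.
- by have := layers_gamma SL 0; rewrite expr0 mulr1.
- by rewrite subnn.
move=> _ _ /ideal_gen1P[c ->] /ideal_gen1P[d ->].
have -> : c * g * (d * g) = c * d * (g * (g * 1)) by ring.
by rewrite (layer_sq SL) mulr0.
Qed.

(** The ideal squares to zero because [f ^+ (2 * omega)] and [g * f ^+ e]
    vanish. *)
Lemma typeIV_isodual_zero omega (T : {set R}) :
  let C := code_of (ideal_gen [:: f ^+ omega; g * f ^+ (e - omega)]) in
  (omega < e)%N -> (e < 2 * omega)%N -> f ^+ (2 * omega) = 0 ->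
  (exists k, has_layers g f (ideal_gen [:: f ^+ omega]) omega k /\
    (e - omega < k <= omega)%N) ->
  isIV T omega 0 0 (e - omega) C /\
  isodual_constacyclic alpha C.
Proof.
move=> C lt_we lt_ew f2w [k [Lk /andP[lt_k le_k]]].
have genE : genGA omega 0 0 = f ^+ omega by rewrite /genG mulr0 addr0.
have Lk' : has_layers g f (ideal_gen [:: f ^+ omega + g * 0]) omega k.
  by rewrite mulr0 addr0.
split.
  exists k; rewrite genE; split=> //; rewrite ?lt_k //.
    by apply: is_kappa_layers Lk; lia.
  by split; [rewrite eqxx|left].
apply: (self_annihilating_isodual (w := omega) (k := (e - omega)%N)) => //.
- exact: ideal_gen_is_ideal.
- have := layers_add Lk' (ltnW lt_k); by rewrite mulr0 addr0.
- exact: ltnW.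
move=> _ _ /ideal_gen2P[c1 [d1 ->]] /ideal_gen2P[c2 [d2 ->]].
have -> : (c1 * f ^+ omega + d1 * (g * f ^+ (e - omega))) *
  (c2 * f ^+ omega + d2 * (g * f ^+ (e - omega)))
  = c1 * c2 * f ^+ omega ^+ 2
    + (c1 * d2 + d1 * c2) * (g * f ^+ ((e - omega) + omega))
    + d1 * d2 * (g * (g * f ^+ (e - omega) ^+ 2)).
  by rewrite exprD; ring.
rewrite -exprM mulnC f2w subnK ?(layer_top SL) ?(layer_sq SL) 1?ltnW //.
by ring.
Qed.

Section Nilpotent.
Hypothesis f_top : f ^+ e = 0.

Lemma f_zero k : (e <= k)%N -> f ^+ k = 0.
Proof. by move=> le; rewrite -(subnKC le) exprD f_top mul0r. Qed.

(** The number kappa of the generator [genG] when [f ^+ e = 0]. *)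
Definition kappaG omega t (G : A) : nat :=
  if G == 0 then omega else minn omega (e - omega + t).

(** When [G = 0] the generator times [f ^+ (e - omega)] vanishes; it is then
    read as [g * f ^+ e]. *)
Lemma genG_layers omega t (G : A) : (omega <= e)%N -> G = 0 \/ invertible G ->
  has_layers g f (ideal_gen [:: genGA omega t G]) omega
    (kappaG omega t G).
Proof.
move=> le_we Ginv; rewrite /genG -mulrA /kappaG.
case: eqP => [->|G0].
  rewrite mulr0 -{3}(minn_idPl le_we).
  apply: (layers_principal SL (U := 1)) => //; last by exists 1; rewrite !mulr1.
  by rewrite mulr0 addr0 -exprD subnK // f_top mulr1 mulr0.
case: Ginv => // -[W EW].
apply: (layers_principal SL (U := G)) => //; last by exists W; rewrite EW mulr1.
by rewrite mulrDr -exprD subnK // f_top add0r exprD; ring.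
Qed.

Lemma typeIII_layers omega t (G : A) (T : {set R}) C :
  isIII T omega t G C ->
  [/\ (0 < omega < e)%N, C = code_of (ideal_gen [:: genGA omega t G])
    & has_layers g f (ideal_gen [:: genGA omega t G]) omega
        (kappaG omega t G)].
Proof.
move=> [kappa [/andP[w_gt0 lt_we] _ [_ adm] ->]]; split=> //.
  by rewrite w_gt0.
apply: genG_layers; first exact: ltnW.
by case: adm => [->|[Ginv _]]; [left|right].
Qed.

Lemma kappaG_le omega t (G : A) : (kappaG omega t G <= omega)%N.
Proof. by rewrite /kappaG; case: ifP => // _; rewrite geq_minl. Qed.

Lemma typeIII_isodual_kappa omega t (G : A) (T : {set R}) C :
  isIII T omega t G C -> isodual C ->
  kappaG omega t G = (e - omega)%N.
Proof.
case/typeIII_layers => /andP[w_gt0 lt_we] -> L iso.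
apply: (isodual_layers (ideal_gen_is_ideal _) L) => //; first exact: ltnW.
by rewrite (leq_trans (kappaG_le _ _ _)) // ltnW.
Qed.

(** The square loses its cross term in characteristic two, whatever [G]. *)
Lemma genG_sq omega t (G : A) : (2%:R : A) = 0 -> (e <= 2 * omega)%N ->
  genGA omega t G ^+ 2 = 0.
Proof.
move=> two0 le; rewrite /genG.
have -> : (f ^+ omega + g * f ^+ t * G) ^+ 2
  = f ^+ omega ^+ 2 + 2%:R * (f ^+ omega * (g * f ^+ t * G))
   + g * (g * (f ^+ t * G) ^+ 2) by ring.
by rewrite two0 mul0r (layer_sq SL) -exprM mulnC f_zero // !addr0.
Qed.

Lemma typeIII_isodual_char2 omega t (G : A) (T : {set R}) C :
  (2%:R : A) = 0 ->
  isIII T omega t G C -> kappaG omega t G = (e - omega)%N ->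
  isodual_constacyclic alpha C.
Proof.
move=> two0 /typeIII_layers[/andP[w_gt0 lt_we] -> L] Ek.
have gen2 : genGA omega t G ^+ 2 = 0.
  by apply: genG_sq => //; have := kappaG_le omega t G; lia.
apply: (self_annihilating_isodual (ideal_gen_is_ideal _) L) => //.
  exact: ltnW.
move=> _ _ /ideal_gen1P[c ->] /ideal_gen1P[d ->].
by rewrite mulrACA -expr2 gen2 mulr0.
Qed.

Lemma typeIV_layers omega t (G : A) mu (T : {set R}) C :
  isIV T omega t G mu C ->
  [/\ (mu < omega < e)%N,
      C = code_of (ideal_gen [:: genGA omega t G; g * f ^+ mu])
    & has_layers g f
        (ideal_gen [:: genGA omega t G; g * f ^+ mu]) omega mu].
Proof.
move=> [kappa [[gk mink] /andP[lt_mk le_kw] lt_we [_ adm] ->]].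
have L : has_layers g f (ideal_gen [:: genGA omega t G]) omega
    (kappaG omega t G).
  apply: genG_layers; first exact: ltnW.
  by case: adm => [->|[Ginv _]]; [left|right].
have Ekap : kappa = kappaG omega t G.
  apply: (layers_unique SL L) => //.
  by rewrite (leq_trans (kappaG_le _ _ _)) // ltnW.
split=> //; first by rewrite lt_we (leq_trans lt_mk le_kw).
move: L; rewrite /genG -mulrA => L; apply: layers_add L _.
by rewrite -Ekap ltnW.
Qed.

Lemma typeIV_isodual_char2 omega t (G : A) mu (T : {set R}) C :
  (2%:R : A) = 0 ->
  isIV T omega t G mu C ->
  isodual_constacyclic alpha C <-> mu = (e - omega)%N.
Proof.
move=> two0 /typeIV_layers[/andP[lt_mw lt_we] -> L].
split=> [[_ iso]|Emu].
  by apply: (isodual_layers (ideal_gen_is_ideal _) L) => //; lia.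
have gen2 : genGA omega t G ^+ 2 = 0 by apply: genG_sq => //; lia.
apply: (self_annihilating_isodual (ideal_gen_is_ideal _) L) => //.
  exact: ltnW.
move=> _ _ /ideal_gen2P[c1 [d1 ->]] /ideal_gen2P[c2 [d2 ->]].
have cross : g * f ^+ mu * genGA omega t G = 0.
  rewrite /genG.
  have -> : g * f ^+ mu * (f ^+ omega + g * f ^+ t * G)
    = g * f ^+ (mu + omega) + g * (g * (f ^+ (mu + t) * G)).
    by rewrite !exprD; ring.
  by rewrite (layer_sq SL) f_zero ?mulr0 ?addr0 //; lia.
set u := genG _ _ _ _ _ in gen2 cross *.
have -> : (c1 * u + d1 * (g * f ^+ mu)) * (c2 * u + d2 * (g * f ^+ mu))
  = c1 * c2 * u ^+ 2 + (c1 * d2 + d1 * c2) * (g * f ^+ mu * u)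
    + d1 * d2 * (g * (g * f ^+ mu ^+ 2)) by ring.
by rewrite gen2 cross (layer_sq SL) !mulr0 !addr0.
Qed.

End Nilpotent.
End Isodual.

(** * Prime power lengths *)

Section PrimePower.
Variables (R : finComUnitRingType) (gamma alpha0 : R) (p n k : nat).
Hypotheses (p_prime : prime p) (n_gt0 : (0 < n)%N).
Local Notation e := (p ^ k.+1)%N.
Local Notation alpha := (alpha0 ^+ e).
Local Notation A := (Ralpha n e alpha).
Local Notation toA := (to_Ralpha n e alpha).
Local Notation g := (gammaR gamma n e alpha).
Local Notation f := (fR n e alpha0 alpha).

Lemma prime_power_gt0 : (0 < e)%N. Proof. by rewrite expn_gt0 prime_gt0. Qed.

Lemma length_gt0 : (0 < n * e)%N.
Proof. by rewrite muln_gt0 n_gt0 prime_power_gt0. Qed.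

Lemma modulus_split r : p%:R = gamma * r -> exists v : {poly R},
  ('X^n - alpha0%:P) ^+ e = 'X^(n * e) - alpha%:P + gamma%:P * v.
Proof.
move=> pr.
have [y Ey] := exprD_prime_pow p_prime ('X^n - alpha0%:P) (alpha0%:P) k.+1.
exists (- (r%:P * y)); move: Ey; rewrite subrK -exprM -polyC_exp => ->.
by rewrite -polyC_natr pr polyCM; ring.
Qed.

Lemma natr_Ralpha j : (j%:R : A) = toA j%:R%:P.
Proof. by rewrite polyC_natr to_Ralpha_nat. Qed.

Lemma fD_alpha0 : f + toA alpha0%:P = toA 'X^n.
Proof. by rewrite /fR -to_RalphaD subrK. Qed.

(** Expand x^N = (f + alpha0)^(p^(k+1)) and compare with
    x^N = alpha = alpha0^(p^(k+1)). *)
Lemma f_top (p_sq : (p%:R : R) ^+ 2 = 0) : exists y : A,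
  f ^+ e = - (p%:R * f ^+ (p ^ k) *
     (toA alpha0%:P ^+ (p ^ k * p.-1) + f ^+ (p ^ k) * y)).
Proof.
have p2 : (p%:R : A) ^+ 2 = 0.
  by rewrite natr_Ralpha -to_RalphaX -polyC_exp p_sq to_Ralpha0.
have [y] := exprD_prime_pow_sq p_prime f (toA alpha0%:P) k p2.
have -> : (f + toA alpha0%:P) ^+ e = toA alpha%:P.
  by rewrite fD_alpha0 -to_RalphaX -exprM to_RalphaXN //; exact: length_gt0.
have -> : toA alpha0%:P ^+ e = toA alpha%:P by rewrite -to_RalphaX -polyC_exp.
set c := toA alpha%:P => E; exists y.
have -> : f ^+ e = f ^+ e + c - c by ring.
rewrite [X in _ - X]E exprM; ring.
Qed.

Lemma f_top_char_p : p%:R = 0 :> R -> f ^+ e = 0.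
Proof.
move=> p0; have [|y ->] := f_top; first by rewrite p0 expr0n.
by rewrite natr_Ralpha p0 to_Ralpha0 !mul0r oppr0.
Qed.

Hypothesis gamma_max : maximal_ideal (ideal_gen [:: gamma]).
Hypothesis gamma_neq0 : gamma != 0.
Hypothesis gamma_sq : gamma ^+ 2 = 0.

Lemma prime_power_two_layered : (p%:R : R) ^+ 2 = 0 -> two_layered g f e.
Proof.
move=> p_sq.
have [r pr] := nilpotent_in_gamma gamma_max gamma_neq0 gamma_sq p_sq.
apply: Ralpha_two_layered => //; first exact: prime_power_gt0.
exact: modulus_split pr.
Qed.

(** Since [p] is nonzero it is [gamma] times a unit, so [f_top] reads
    f^e = gamma f^(p^k) U with U a unit. *)
Lemma f_power_layers omega : (p%:R : R) ^+ 2 = 0 -> p%:R != 0 :> R ->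
  alpha0 \is a GRing.unit -> (omega <= e)%N ->
  has_layers g f (ideal_gen [:: f ^+ omega]) omega (minn omega (p ^ k)).
Proof.
move=> p_sq p_neq0 a0_unit le_we.
have SL := prime_power_two_layered p_sq.
have [r pr] := nilpotent_in_gamma gamma_max gamma_neq0 gamma_sq p_sq.
have [y top] := f_top p_sq.
case: (gamma_dichotomy gamma_max gamma_sq r) => [[b rb]|[c Ec]].
  by move: p_neq0; rewrite pr rb mulrA -expr2 gamma_sq mul0r eqxx.
have pg : (p%:R : A) = g * toA r%:P.
  by rewrite natr_Ralpha pr polyCM to_RalphaM.
have Eg : g * (toA r%:P * toA c%:P) = g.
  by rewrite /gammaR -!to_RalphaM -!polyCM -Ec.
set a := toA alpha0%:P ^+ _ in top.
have pk_gt0 : (0 < p ^ k)%N by rewrite expn_gt0 prime_gt0.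
have [W EW] : exists W, g * ((a + f ^+ (p ^ k) * y) * W) = g.
  apply: (layer_unitD (b := toA (alpha0^-1 ^+ (p ^ k * p.-1))%:P)) SL _ pk_gt0.
  rewrite /a -to_RalphaX -polyC_exp -to_RalphaM -polyCM -exprMn mulrV //.
  by rewrite expr1n -[toA 1%:P]/(toA 1%:R) to_Ralpha_nat mulr1.
have -> : f ^+ omega = f ^+ omega + g * 0 by rewrite mulr0 addr0.
apply: (layers_principal SL (U := - (toA r%:P * (a + f ^+ (p ^ k) * y)))) => //.
  by rewrite mulr0 addr0 -exprD subnK // top pg; ring.
exists (- (toA c%:P * W)).
have -> : g * (- (toA r%:P * (a + f ^+ (p ^ k) * y)) * - (toA c%:P * W))
  = g * (toA r%:P * toA c%:P) * ((a + f ^+ (p ^ k) * y) * W) by ring.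
by rewrite Eg.
Qed.

End PrimePower.

(** The sign of alpha0 is absorbed in [beta], the power of [- alpha0], whose
    square is alpha.  Both [f ^+ (2 ^ k) - (Z + b)] and [2 * b] are multiples of
    [g], which brings the generator and its cofactor to the form required by
    [annihilator_cofactor]. *)
Lemma half_power_isodual (R : finComUnitRingType) (gamma alpha0 : R) (n k : nat)
    (w : Ralpha n (2 ^ k.+1) (alpha0 ^+ (2 ^ k.+1))) :
  let alpha := alpha0 ^+ (2 ^ k.+1) in
  let f := fR n (2 ^ k.+1) alpha0 alpha in
  let g := gammaR gamma n (2 ^ k.+1) alpha in
  (0 < n)%N -> maximal_ideal (ideal_gen [:: gamma]) -> gamma != 0 ->
  gamma ^+ 2 = 0 -> (2%:R : R) ^+ 2 = 0 ->
  isodual_constacyclic alpha (code_of (ideal_gen [:: f ^+ (2 ^ k) + g * w])).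
Proof.
move=> alpha f g n_gt0 gamma_max gamma_neq0 gamma_sq two_sq.
have SL : two_layered g f (2 ^ k.+1) by exact: prime_power_two_layered.
have NN : (0 < n * 2 ^ k.+1)%N by exact: length_gt0.
have [r tr] := nilpotent_in_gamma gamma_max gamma_neq0 gamma_sq two_sq.
have gamma2 : gamma *+ 2 = 0.
  by rewrite -mulr_natr tr mulrA -expr2 gamma_sq mul0r.
pose toA := to_Ralpha n (2 ^ k.+1) alpha.
have tg : 2%:R = g * toA r%:P by rewrite natr_Ralpha tr polyCM to_RalphaM.
have gg : g ^+ 2 = 0 by rewrite -to_RalphaX -polyC_exp gamma_sq to_Ralpha0.
have g2 : g *+ 2 = 0.
  by rewrite -mulr_natr tg mulrA -expr2 gg mul0r.
pose H := (n * 2 ^ k)%N; pose beta := (- alpha0) ^+ (2 ^ k).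
have beta_sq : beta ^+ 2 = alpha.
  by rewrite -exprM -expnSr expnS exprM sqrrN -exprM -expnS.
pose Z := toA 'X^H; pose b := toA beta%:P.
have [w' Ew'] : exists w', f ^+ (2 ^ k) + g * w = Z + b + g * w'.
  have [y] := exprD_prime_pow (isT : prime 2) (toA 'X^n) (toA (- alpha0)%:P) k.
  have -> : toA 'X^n + toA (- alpha0)%:P = f.
    by rewrite /toA -to_RalphaD polyCN.
  move=> ->; exists (toA r%:P * y + w).
  rewrite tg /Z /b /toA -!to_RalphaX -exprM -polyC_exp; ring.
have idI := ideal_gen_is_ideal [:: f ^+ (2 ^ k) + g * w].
split; first exact: code_of_constacyclic.
apply: (isodual_of_annihilator NN (d := half_sign R H) idI) => [i|].
  by rewrite /half_sign; case: ifP; rewrite ?unitrN ?unitr1.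
have half : (2 ^ k.+1 - 2 ^ k = 2 ^ k)%N by rewrite expnS; lia.
have cofE : Z - b + g * w' = f ^+ (2 ^ k.+1 - 2 ^ k) + g * (w - toA r%:P * b).
  rewrite half mulrBr addrA Ew'.
  have -> : g * (toA r%:P * b) = 2%:R * b by rewrite tg; ring.
  ring.
have le2 : (2 ^ k <= 2 ^ k.+1)%N by rewrite expnS; lia.
have H2 : (n * 2 ^ k.+1 = H + H)%N by rewrite expnS /H; lia.
rewrite (@annihilator_cofactor _ g f (2 ^ k.+1) (2 ^ k) w (w - toA r%:P * b))
  // -cofE Ew'; first exact: code_of_half_neg.
have ZZ : Z ^+ 2 = b ^+ 2.
  rewrite /Z /b /toA -!to_RalphaX -exprM muln2 -addnn -H2 to_RalphaXN //.
  by rewrite -polyC_exp beta_sq.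
have -> : (Z + b + g * w') * (Z - b + g * w')
  = Z ^+ 2 - b ^+ 2 + g *+ 2 * (Z * w') + g ^+ 2 * w' ^+ 2 by ring.
by rewrite ZZ gg g2 subrr !mul0r !addr0.
Qed.

Lemma has_char_unique (S : finComNzRingType) (c d : nat) :
  has_char S c -> has_char S d -> c = d.
Proof.
move=> Hc Hd; apply/eqP.
by rewrite eqn_dvd -Hc -Hd Hd dvdnn Hc dvdnn.
Qed.

Unset Implicit Arguments.

Theorem corollary3p2
  (R : finComUnitRingType) (gamma zeta alpha0 alpha : R) (p m n s : nat)
  (R_chain : chain_ring R)
  (gamma_max : maximal_ideal (ideal_gen [:: gamma]))
  (gamma_neq0 : gamma != 0) (gamma_sq : gamma ^+ 2 = 0)
  (p_prime : prime p)
  (residue_order : quotient_order (ideal_gen [:: gamma]) = (p ^ m)%N)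
  (char_R : has_char R p \/ has_char R (p ^ 2))
  (zeta_order : (p ^ m).-1.-primitive_root zeta)
  (n_gt0 : (0 < n)%N) (s_gt0 : (0 < s)%N) (coprime_np : coprime n p) :
  let T := teichmuller_set zeta (p ^ m).-1 in
  alpha0 \in T ->
  alpha \in T :\ 0 ->
  alpha = alpha0 ^+ (p ^ s) ->
  irreducible_elt ('X^n - alpha0%:P : {poly R}) ->
  let Code := {set 'rV[R]_(n * p ^ s)} in
  let Ra := Ralpha n (p ^ s) alpha in
  let f : Ra := fR n (p ^ s) alpha0 alpha in
  let g : Ra := gammaR gamma n (p ^ s) alpha in
  let code (gs : seq Ra) : Code := code_of (ideal_gen gs) in
  let isTypeII : Code -> Prop :=
    @typeII R gamma n (p ^ s) alpha0 alpha in
  let isTypeIII : nat -> nat -> Ra -> Code -> Prop :=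
    @typeIII R gamma T n (p ^ s) alpha0 alpha in
  let isTypeIV : nat -> nat -> Ra -> nat -> Code -> Prop :=
    @typeIV R gamma T n (p ^ s) alpha0 alpha in
  [/\ (* (a) *)
      forall C : Code,
        (isTypeII C /\ isodual_constacyclic alpha C) <-> C = code [:: g],
      (* (b) *)
      [/\ (odd p -> has_char R p ->
            ~ exists (C : Code) (omega t : nat) (G : Ra),
                [/\ isTypeIII omega t G C, isodual_constacyclic alpha C
                  & G = 0 \/ G != 0 /\ (2 * omega <= p ^ s + t)%N]),
          (has_char R 2 ->
            forall C : Code,
              ((exists omega t G, isTypeIII omega t G C) /\
               isodual_constacyclic alpha C) <->
              (exists (omega t : nat) (G : Ra),
                isTypeIII omega t G C /\
                [\/ omega = (2 ^ s.-1)%N /\ G = 0,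
                    omega = (2 ^ s.-1)%N /\ G != 0
                  | [/\ (2 ^ s.-1 < omega)%N, t = 0%N & G != 0]]))
        & (has_char R 4 ->
            (isTypeIII (2 ^ s.-1)%N 0%N 0 (code [:: f ^+ (2 ^ s.-1)]) /\
             isodual_constacyclic alpha (code [:: f ^+ (2 ^ s.-1)])) /\
            (forall (t : nat) (G : Ra) (kappa : nat),
               (1 <= t)%N -> G != 0 ->
               let gen := f ^+ (2 ^ s.-1) + g * f ^+ t * G in
               is_kappa gamma alpha0 gen kappa ->
               admissible T alpha0 kappa t G ->
               isTypeIII (2 ^ s.-1)%N t G (code [:: gen]) /\
               isodual_constacyclic alpha (code [:: gen])))]
    & (* (c) *)
      [/\ (has_char R 2 ->
            forall C : Code,
              ((exists omega t G mu, isTypeIV omega t G mu C) /\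
               isodual_constacyclic alpha C) <->
              (exists (omega t : nat) (G : Ra),
                [/\ isTypeIV omega t G (2 ^ s - omega)%N C,
                    (2 ^ s.-1 < omega < 2 ^ s)%N
                  & G != 0 -> (t < 2 ^ s - omega)%N])),
          (odd p -> has_char R p ->
            forall omega : nat,
              (p ^ s < 2 * omega)%N -> (omega < p ^ s)%N ->
              let C := code [:: f ^+ omega; g * f ^+ (p ^ s - omega)] in
              isTypeIV omega 0%N 0 (p ^ s - omega)%N C /\
              isodual_constacyclic alpha C)
        & (has_char R (p ^ 2) ->
            forall omega : nat,
              (2 * p ^ s - p ^ s.-1 <= 2 * omega)%N -> (omega < p ^ s)%N ->
              let C := code [:: f ^+ omega; g * f ^+ (p ^ s - omega)] in
              isTypeIV omega 0%N 0 (p ^ s - omega)%N C /\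
              isodual_constacyclic alpha C)]].
Proof.
move=> T a0T; rewrite in_setD1 => /andP[alpha_neq0 _] alphaE _.
case: s s_gt0 alphaE => // k _ alphaE.
subst alpha; move=> Code Ra f g code isII isIII isIV.
have p_gt1 := prime_gt1 p_prime.
have a0_unit : alpha0 \is a GRing.unit.
  move: a0T; rewrite !inE => /orP[/eqP a00|/imsetP[i _ ->]].
    move: alpha_neq0; rewrite a00 expr0n expn_eq0 -leqn0 leqNgt.
    by rewrite prime_gt0 ?eqxx.
  apply: unitrX; apply/unitrP; exists (zeta ^+ (p ^ m).-2).
  have d_gt0 := prim_order_gt0 zeta_order.
  by rewrite -exprSr -exprS prednK // prim_expr_order.
have charE c : has_char R c -> c%:R = 0 :> R by move=> H; apply/eqP; rewrite H.
have p_sq : (p%:R : R) ^+ 2 = 0.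
  case: char_R => /charE; first by move=> ->; rewrite expr0n.
  by rewrite natrX.
have SL : two_layered g f (p ^ k.+1) by exact: prime_power_two_layered.
have N_gt0 : (0 < n * p ^ k.+1)%N by exact: length_gt0.
have f0 : has_char R p -> f ^+ (p ^ k.+1) = 0.
  by move=> /charE p0; exact: f_top_char_p.
have char2 : has_char R 2 -> p = 2%N.
  move=> R2; case: char_R => /(has_char_unique R2) E; first by [].
  by have := leq_sqr 2 p; rewrite p_gt1 -E.
have char4 : has_char R 4 -> p = 2%N.
  move=> R4; case: char_R => /(has_char_unique R4) E.
    by move: p_prime; rewrite -E.
  by apply/eqP; rewrite -(eqn_exp2r _ _ (isT : 0 < 2)%N) -E.
have fpow_pos : (0 < p ^ k)%N by rewrite expn_gt0 prime_gt0.
split.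
- exact: typeII_isodual.
- split.
  + move=> p_odd /f0 ftop [C [omega [t [G [III [_ iso]]]]]] Gcond.
    have kE := typeIII_isodual_kappa N_gt0 SL ftop III iso.
    have [/andP[_ lt_we] _ _] := typeIII_layers SL ftop III.
    have odd_e : odd (p ^ k.+1) by rewrite oddX p_odd orbT.
    (* Then [omega = e - omega], whereas [e] is odd. *)
    have kw : kappaG omega t G = omega.
      rewrite /kappaG; case: eqP Gcond => // G0 [//|[_ le]].
      by apply/minn_idPl; lia.
    have e_even : (p ^ k.+1 = omega + omega)%N by lia.
    by move: odd_e; rewrite e_even oddD addbb.
  + move=> R2 C; have two0 := charE _ R2; have p2 := char2 R2.
    subst p; have ftop := f0 R2.
    have two0A : (2%:R : Ra) = 0 by rewrite natr_Ralpha two0 to_Ralpha0.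
    have e2 : (2 ^ k.+1 = 2 ^ k + 2 ^ k)%N by rewrite expnS; lia.
    split=> [[[omega [t [G III]]] [_ iso]]|[omega [t [G [III cond]]]]].
      exists omega, t, G; split=> //.
      have := typeIII_isodual_kappa N_gt0 SL ftop III iso.
      have [/andP[_ lt_we] _ _] := typeIII_layers SL ftop III.
      rewrite /kappaG /=; case: eqP => [G0|G0] kE.
        by apply: Or31; split=> //; lia.
      have [->|neq] := eqVneq omega (2 ^ k)%N; first by apply: Or32; split.
      by apply: Or33; split; lia.
    split; first by exists omega, t, G.
    apply: (typeIII_isodual_char2 N_gt0 SL ftop two0A III).
    have [/andP[_ lt_we] _ _] := typeIII_layers SL ftop III.
    rewrite /kappaG; case: cond => /= [[-> ->]|[-> /negPf->]|[lt -> /negPf->]].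
    * by rewrite eqxx; lia.
    * by apply/eqP; lia.
    * by apply/eqP; lia.
  move=> R4; move: (char4 R4) => p2; subst p.
  have e2 : (2 ^ k < 2 ^ k.+1)%N by rewrite expnS; lia.
  have iso w : isodual_constacyclic (alpha0 ^+ (2 ^ k.+1))
      (code [:: f ^+ (2 ^ k) + g * w]) by exact: half_power_isodual.
  split.
    split; last by have := iso 0; rewrite mulr0 addr0.
    have p_neq0 : 2%:R != 0 :> R by rewrite R4.
    have L := f_power_layers p_prime n_gt0 gamma_max gamma_neq0 gamma_sq p_sq
      p_neq0 a0_unit (ltnW e2).
    rewrite minnn in L.
    exists (2 ^ k)%N; rewrite /genG mulr0 addr0; split=> //=.
    - by rewrite fpow_pos.
    - exact: (is_kappa_layers SL (ltnW e2) L).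
    - by split; [rewrite eqxx|left].
  move=> t G kappa t_gt0 G0 gen Hk adm; split.
    by exists kappa; split=> //=; rewrite fpow_pos.
  by rewrite /gen -mulrA; apply: iso.
- split.
  + move=> R2 C; have two0 := charE _ R2; have p2 := char2 R2.
    subst p; have ftop := f0 R2.
    have two0A : (2%:R : Ra) = 0 by rewrite natr_Ralpha two0 to_Ralpha0.
    have e2 : (2 ^ k.+1 = 2 ^ k + 2 ^ k)%N by rewrite expnS; lia.
    split=> [[[omega [t [G [mu IV]]]] iso]|[omega [t [G [IV _ _]]]]].
      have Emu := (typeIV_isodual_char2 N_gt0 SL ftop two0A IV).1 iso.
      have [/andP[lt_mw lt_we] _ _] := typeIV_layers SL ftop IV.
      exists omega, t, G; rewrite -Emu; split=> //; first by rewrite /=; lia.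
      by case: IV => kappa [_ _ _ [adm _] _].
    split; first by exists omega, t, G, (2 ^ k.+1 - omega)%N.
    exact: (typeIV_isodual_char2 N_gt0 SL ftop two0A IV).2.
  + move=> p_odd /f0 ftop omega lt_ew lt_we.
    apply: (typeIV_isodual_zero N_gt0 SL) => //.
      by rewrite (f_zero ftop) //; lia.
    exists omega; split; last by lia.
    have := genG_layers SL ftop 0 (ltnW lt_we) (or_introl (erefl (0 : Ra))).
    by rewrite /genG /kappaG eqxx mulr0 addr0.
  move=> Rp2 omega /= le_ew lt_we.
  have p_neq0 : p%:R != 0 :> R.
    by rewrite Rp2 gtnNdvd ?prime_gt0 // -[X in (X < _)%N]expn1 ltn_exp2l.
  have ep : (p ^ k.+1 >= p ^ k + p ^ k)%N.
    by rewrite expnS addnn -mul2n leq_mul2r p_gt1 orbT.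
  have [y ftop] := f_top alpha0 k p_prime n_gt0 p_sq.
  apply: (typeIV_isodual_zero N_gt0 SL) => //; first by lia.
    have [z zE] : exists z, f ^+ (p ^ k.+1) = g * (f ^+ (p ^ k) * z).
      have [r pr] := nilpotent_in_gamma gamma_max gamma_neq0 gamma_sq p_sq.
      rewrite ftop natr_Ralpha pr polyCM to_RalphaM.
      set u := to_Ralpha _ _ _ alpha0%:P ^+ _ + _.
      exists (- (to_Ralpha n (p ^ k.+1) (alpha0 ^+ (p ^ k.+1)) r%:P * u)).
      by rewrite /g /gammaR; ring.
    have -> : (2 * omega = p ^ k.+1 + (2 * omega - p ^ k.+1))%N by lia.
    rewrite exprD zE.
    set j := (2 * omega - p ^ k.+1)%N.
    have -> : g * (f ^+ (p ^ k) * z) * f ^+ j = g * (f ^+ (p ^ k + j) * z).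
      by rewrite exprD; ring.
    by rewrite (layer_le0 SL) // /j; lia.
  exists (minn omega (p ^ k)); split; last by lia.
  exact: f_power_layers (ltnW lt_we).
Qed.
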